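(* If $\hat\rho_1\in\mathcal A_1$ (i.e. $\rho_1$ is $G$-invariant), then $$\liminf_{n\to\infty}\frac1n\log\operatorname{Tr}\bigl|\hat\rho_{0,n}^s\hat\rho_{1,n}^{1-s}\bigr|\ge\log\operatorname{Tr}\bigl|\hat\rho_0^s\hat\rho_1^{1-s}\bigr|\quad\text{if }0\le s\le1/2,$$ $$\limsup_{n\to\infty}\frac1n\log\operatorname{Tr}\bigl|\hat\rho_{0,n}^s\hat\rho_{1,n}^{1-s}\bigr|\le\log\operatorname{Tr}\bigl|\hat\rho_0^s\hat\rho_1^{1-s}\bigr|\quad\text{if }1/2\le s\le1.$$
   Context: Let $\mathcal H$ be a finite-dimensional complex Hilbert space, $G$ a compact group and $g\mapsto u_g$ a continuous unitary representation of $G$ on $\mathcal H$. For $n\in\mathbb N$ let $\mathcal A_n=\{A\in\mathcal B(\mathcal H^{\otimes n}):Au_g^{\otimes n}=u_g^{\otimes n}A\ \forall g\in G\}$ and $E_{\mathcal A_n}(X)=\int_G u_g^{\otimes n}Xu_g^{*\otimes n}\,dg$ (normalized Haar measure). Let $\hat\rho_0,\hat\rho_1$ be density matrices on $\mathcal H$ and $\hat\rho_{k,n}:=E_{\mathcal A_n}(\hat\rho_k^{\otimes n})$, $k=0,1$. Powers of positive semidefinite operators use the convention $0^s=0$ for all real $s$; $|X|=(X^*X)^{1/2}$; $\log0=-\infty$. *)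

(* Defs.v *)
From HB Require Import structures.
From mathcomp Require Import all_boot all_order all_algebra.
From mathcomp Require Import complex mxtens.
From mathcomp Require Import all_classical all_reals all_analysis.

Set Implicit Arguments.
Unset Strict Implicit.
Unset Printing Implicit Defensive.

Import Order.TTheory GRing.Theory Num.Theory.
Import numFieldNormedType.Exports.
Local Open Scope ring_scope.

Section Defs.
Variable R : realType.
Local Notation C := (R[i]).

Definition adjmx m n (A : 'M[C]_(m, n)) : 'M[C]_(n, m) := (map_mx Num.conj A)^T.

Definition unitary_mx n (U : 'M[C]_n) : Prop := U *m adjmx U = 1%:M.

Definition psd_mx n (A : 'M[C]_n) : Prop :=
  adjmx A = A /\ forall v : 'rV[C]_n, 0 <= (v *m A *m adjmx v) 0 0.

Definition density_mx n (A : 'M[C]_n) : Prop := psd_mx A /\ \tr A = 1.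

Definition eig_pow (z : C) (s : R) : C :=
  if z == 0 then 0 else (powR (complex.Re z) s)%:C%C.

(* Real power A^s of a positive semidefinite matrix through the spectral
   decomposition A = P^-1 diag(d) P (P unitary) of mathcomp's spectral.v,
   with 0^s = 0 on the eigenvalue 0. *)
Definition mxpow n (A : 'M[C]_n) (s : R) : 'M[C]_n :=
  invmx (spectralmx A) *m diag_mx (\row_j eig_pow (spectral_diag A 0 j) s)
    *m spectralmx A.

Definition absmx n (X : 'M[C]_n) : 'M[C]_n := mxpow (adjmx X *m X) (2^-1).
Definition trnorm n (X : 'M[C]_n) : R := complex.Re (\tr (absmx X)).

Definition elog (x : R) : \bar R := if x == 0 then -oo%E else (ln x)%:E.

Definition is_compact_group (G : topologicalType)
    (mul : G -> G -> G) (inv : G -> G) (one : G) : Prop :=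
  [/\ (forall a b c, mul a (mul b c) = mul (mul a b) c),
      (forall a, mul one a = a),
      (forall a, mul (inv a) a = one),
      (continuous (fun p : G * G => mul p.1 p.2) /\ continuous inv) &
      (hausdorff_space G /\ compact [set: G])].

(* Normalized Haar integral on C(G): a positive, normalized, left-invariant
   linear functional on continuous real functions (Riesz: equivalently, the
   integral against the normalized Haar measure). *)
Definition haar_integral (G : topologicalType) (mul : G -> G -> G)
    (I : (G -> R) -> R) : Prop :=
  [/\ (forall f g : G -> R, continuous f -> continuous g ->
          I (fun x => f x + g x) = I f + I g),
      (forall (c : R) (f : G -> R), continuous f -> I (fun x => c * f x) = c * I f),
      (forall f : G -> R, continuous f -> (forall x, 0 <= f x) -> 0 <= I f),
      I (fun _ => 1) = 1 &
      (forall a (f : G -> R), continuous f -> I (fun x => f (mul a x)) = I f)].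

Definition unitary_rep (G : topologicalType) (mul : G -> G -> G) k
    (u : G -> 'M[C]_k) : Prop :=
  [/\ (forall g, unitary_mx (u g)),
      (forall a b, u (mul a b) = u a *m u b) &
      (forall i j, continuous (fun g => complex.Re (u g i j)) /\
                   continuous (fun g => complex.Im (u g i j)))].

Definition tpow_rep (G : Type) k (u : G -> 'M[C]_k) n (g : G) : 'M[C]_(k ^ n) :=
  ntensmx (u g) n.

(* E_{A_n}(X) = \int_G u_g^{(x)n} X u_g^{*(x)n} dg, entrywise (real and
   imaginary parts) against the Haar integral I. *)
Definition Eavg (G : Type) k (u : G -> 'M[C]_k) (I : (G -> R) -> R) n
    (X : 'M[C]_(k ^ n)) : 'M[C]_(k ^ n) :=
  \matrix_(i, j)
    Complex (I (fun g => complex.Re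
                  ((tpow_rep u n g *m X *m adjmx (tpow_rep u n g)) i j)))
            (I (fun g => complex.Im
                  ((tpow_rep u n g *m X *m adjmx (tpow_rep u n g)) i j))).

Definition rho_n (G : Type) k (u : G -> 'M[C]_k) (I : (G -> R) -> R)
    (rho : 'M[C]_k) n : 'M[C]_(k ^ n) :=
  Eavg u I (ntensmx rho n).

Definition rate_seq (G : Type) k (u : G -> 'M[C]_k) (I : (G -> R) -> R)
    (rho0 rho1 : 'M[C]_k) (s : R) : (\bar R)^nat :=
  fun n => (((n%:R)^-1)%:E *
    elog (trnorm (mxpow (rho_n u I rho0 n) s *m mxpow (rho_n u I rho1 n) (1 - s))))%E.

End Defs.

(* Main.v *)
Require Import Defs.
From HB Require Import structures.
From mathcomp Require Import all_boot all_order all_algebra.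
From mathcomp Require Import complex mxtens.
From mathcomp Require Import all_classical all_reals all_analysis.
From mathcomp Require Import ring lra.
Import Order.TTheory GRing.Theory Num.Theory.
Import numFieldNormedType.Exports.
Local Open Scope ring_scope.

(* Write E for the average over G of X |-> U_g X U_g* on the n-th tensor power,
   A for the n-th tensor power of rho0, B for that of rho1, so that E(B) = B and
   Tr|E(A)^s B^(1-s)| = Tr (B^(1-s) E(A)^(2s) B^(1-s))^(1/2).

   For s <= 1/2, the operator Jensen inequality E(A^t) <= E(A)^t, 0 <= t <= 1,
   and the monotonicity of Tr sqrt give the lower bound
   Tr sqrt E(Y) >= Tr sqrt Y with Y = B^(1-s) A^(2s) B^(1-s), and Tr sqrt Y is
   the n-th power of its value at n = 1. The Jensen inequality is proved for
   dyadic t from the inequality 2 Re (v X^m w* ) <= v X^p v* + w X^q w* with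
   m = (p + q) / 2, which is preserved by E.

   For s >= 1/2, E(A)^t <= E(A^t), 1 <= t <= 2, follows from the same inequality,
   and it remains to show Tr sqrt E(Y) <= sqrt N Tr sqrt Y with N subexponential.
   For a vector e the operator Q = E(e* e) has rank at most N = (n + 1)^(k * k),
   because the entries of U_g are monomials of degree n in those of u_g, and
   e* e <= N Q because e Q^-1 e* = Tr (Q^-1 Q) by covariance. Applied to the
   eigenvectors of Y this bounds Tr (E(Y)^(-1/2) Y) = Tr sqrt E(Y). *)

Lemma le_of_subr_sub (K : numDomainType) (a b c d : K) :
  0 <= a - b - c + d -> b + c <= a + d.
Proof. by move=> h; rewrite -subr_ge0 (_ : _ - _ = a - b - c + d) //; ring. Qed.

Lemma le_of_sqr (K : numDomainType) (a b : K) :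
  0 <= a -> 0 <= b -> a ^+ 2 <= b ^+ 2 -> a <= b.
Proof. by move=> a0 b0; rewrite ler_pXn2r. Qed.

(** * Adjoints, sesquilinear forms and the Loewner order *)

Section HermitianForms.
Set Implicit Arguments.
Unset Strict Implicit.
Context {C : numClosedFieldType}.

Definition adjm m n (A : 'M[C]_(m, n)) : 'M[C]_(n, m) := (map_mx Num.conj A)^T.

Definition unitarym n (U : 'M[C]_n) : Prop := U *m adjm U = 1%:M.

Definition psdm n (A : 'M[C]_n) : Prop :=
  adjm A = A /\ forall v : 'rV[C]_n, 0 <= (v *m A *m adjm v) 0 0.

Lemma adjmE m n (A : 'M[C]_(m, n)) i j : adjm A i j = Num.conj (A j i).
Proof. by rewrite !mxE. Qed.

Lemma adjmK m n (A : 'M[C]_(m, n)) : adjm (adjm A) = A.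
Proof. by apply/matrixP=> i j; rewrite !adjmE conjCK. Qed.

Lemma adjm_mul m n p (A : 'M[C]_(m, n)) (B : 'M[C]_(n, p)) :
  adjm (A *m B) = adjm B *m adjm A.
Proof. by rewrite /adjm map_mxM trmx_mul. Qed.

Lemma adjmD m n (A B : 'M[C]_(m, n)) : adjm (A + B) = adjm A + adjm B.
Proof. by rewrite /adjm map_mxD linearD. Qed.

Lemma adjmN m n (A : 'M[C]_(m, n)) : adjm (- A) = - adjm A.
Proof. by rewrite /adjm map_mxN linearN. Qed.

Lemma adjmZ m n (c : C) (A : 'M[C]_(m, n)) :
  adjm (c *: A) = Num.conj c *: adjm A.
Proof. by rewrite /adjm map_mxZ linearZ. Qed.

Lemma adjm1 n : adjm (1%:M : 'M[C]_n) = 1%:M.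
Proof. by rewrite /adjm map_mx1 trmx1. Qed.

Lemma unitary_adjl n (P : 'M[C]_n) : unitarym P -> adjm P *m P = 1%:M.
Proof. by move=> /mulmx1C. Qed.

Fact hform_key : unit. Proof. by []. Qed.
Definition hform n : 'M[C]_n -> 'rV[C]_n -> 'rV[C]_n -> C :=
  locked_with hform_key (fun A v w => (v *m A *m adjm w) 0 0).

(** The Loewner order, with vectors acting as rows. Comparable elements of [C] have a real
    difference, so the form of [B - A] is real without a separate clause. *)
Definition lemx n (A B : 'M[C]_n) : Prop :=
  forall v, hform A v v <= hform B v v.

Lemma hformE n (A : 'M[C]_n) v w : hform A v w = (v *m A *m adjm w) 0 0.
Proof. by rewrite /hform unlock. Qed.

Lemma hform_mull n (A X : 'M[C]_n) v w :
  hform A (v *m X) w = hform (X *m A) v w.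
Proof. by rewrite !hformE !mulmxA. Qed.

Lemma hform_mulr n (A X : 'M[C]_n) v w :
  hform A v (w *m X) = hform (A *m adjm X) v w.
Proof. by rewrite !hformE adjm_mul !mulmxA. Qed.

Lemma hformZ n (c : C) (A : 'M[C]_n) v w : hform (c *: A) v w = c * hform A v w.
Proof. by rewrite !hformE -scalemxAr -scalemxAl mxE. Qed.

Lemma hform_sum n (T : finType) (F : T -> 'M[C]_n) v w :
  hform (\sum_i F i) v w = \sum_i hform (F i) v w.
Proof.
rewrite hformE mulmx_sumr mulmx_suml summxE; apply: eq_bigr => i _.
by rewrite hformE.
Qed.

Lemma hformDl n (A : 'M[C]_n) v v' w : hform A (v + v') w = hform A v w + hform A v' w.
Proof. by rewrite !hformE !mulmxDl mxE. Qed.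

Lemma hformDr n (A : 'M[C]_n) v w w' : hform A v (w + w') = hform A v w + hform A v w'.
Proof. by rewrite !hformE adjmD mulmxDr mxE. Qed.

Lemma hformNl n (A : 'M[C]_n) v w : hform A (- v) w = - hform A v w.
Proof. by rewrite !hformE !mulNmx mxE. Qed.

Lemma hformNr n (A : 'M[C]_n) v w : hform A v (- w) = - hform A v w.
Proof. by rewrite !hformE adjmN mulmxN mxE. Qed.

Lemma hformZl n (A : 'M[C]_n) c v w : hform A (c *: v) w = c * hform A v w.
Proof. by rewrite !hformE -!scalemxAl mxE. Qed.

Lemma hformZr n (A : 'M[C]_n) c v w : hform A v (c *: w) = Num.conj c * hform A v w.
Proof. by rewrite !hformE adjmZ -scalemxAr mxE. Qed.

Lemma hform_conj n (A : 'M[C]_n) v w :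
  Num.conj (hform A v w) = hform (adjm A) w v.
Proof.
by rewrite !hformE -adjmE !adjm_mul adjmK mulmxA.
Qed.

Lemma hform1_ge0 n (v : 'rV[C]_n) : 0 <= hform 1%:M v v.
Proof.
by rewrite !hformE mulmx1 mxE sumr_ge0 // => i _; rewrite !mxE mul_conjC_ge0.
Qed.

Lemma hform1_eq0 n (v : 'rV[C]_n) : hform 1%:M v v = 0 -> v = 0.
Proof.
rewrite !hformE mulmx1 mxE => /eqP; rewrite psumr_eq0; last first.
  by move=> i _; rewrite !mxE mul_conjC_ge0.
move=> /allP h; apply/rowP => i; rewrite mxE.
by have := h i (mem_index_enum _); rewrite !mxE /= mul_conjC_eq0 => /eqP.
Qed.

Lemma cauchy_schwarz n (v w : 'rV[C]_n) :
  `|hform 1%:M v w| ^+ 2 <= hform 1%:M v v * hform 1%:M w w.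
Proof.
have E (a b : 'rV[C]_n) : hform 1%:M a b = dotmx a b.
  by rewrite dotmxE hformE mulmx1 -map_trmx.
by rewrite !E; apply: (CauchySchwarz (@dotmx _ n)).
Qed.

Lemma psd_hform n (A : 'M[C]_n) :
  adjm A = A -> (forall v, 0 <= hform A v v) -> psdm A.
Proof. by move=> hA h; split=> // v; rewrite -hformE. Qed.

Lemma psd_hform_ge0 n (A : 'M[C]_n) v : psdm A -> 0 <= hform A v v.
Proof. by case=> _ h; rewrite hformE. Qed.

Lemma psd_adj n (A : 'M[C]_n) : psdm A -> adjm A = A.
Proof. by case. Qed.

Lemma psd_congr n (A X : 'M[C]_n) : psdm A -> psdm (X *m A *m adjm X).
Proof.
move=> [hA pA]; split=> [|v]; first by rewrite !adjm_mul adjmK hA mulmxA.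
by have := pA (v *m X); rewrite adjm_mul !mulmxA.
Qed.

Lemma psd1 n : psdm (1%:M : 'M[C]_n).
Proof. by split=> [|v]; [exact: adjm1 | rewrite -hformE; exact: hform1_ge0]. Qed.

Lemma psd_gram n (X : 'M[C]_n) : psdm (adjm X *m X).
Proof. by have := psd_congr (adjm X) (psd1 n); rewrite mulmx1 adjmK. Qed.

Lemma lemx_congr n (A B X : 'M[C]_n) :
  lemx A B -> lemx (X *m A *m adjm X) (X *m B *m adjm X).
Proof.
by move=> AB v; rewrite -!hform_mulr -!hform_mull; exact: AB.
Qed.

Lemma mxtrace_unitary n (P A : 'M[C]_n) : unitarym P ->
  \tr A = \sum_i hform A (row i P) (row i P).
Proof.
move=> hP; have -> : \tr A = \tr (P *m A *m adjm P).
  by rewrite mxtrace_mulC mulmxA unitary_adjl // mul1mx.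
rewrite /mxtrace; apply: eq_bigr => i _.
rewrite !hformE -row_mul !mxE; apply: eq_bigr => j _.
by rewrite !mxE.
Qed.

Lemma lemx_mxtrace n (A B : 'M[C]_n) : lemx A B -> \tr A <= \tr B.
Proof.
have h1 : unitarym (1%:M : 'M[C]_n) by rewrite /unitarym adjm1 mulmx1.
by move=> AB; rewrite !(mxtrace_unitary _ h1); apply: ler_sum => i _; exact: AB.
Qed.

Lemma hform_mul2 n (A X Y : 'M[C]_n) v w :
  hform A (v *m X) (w *m Y) = hform (X *m A *m adjm Y) v w.
Proof. by rewrite hform_mull hform_mulr. Qed.

Lemma hformB2 n (A : 'M[C]_n) v w :
  hform A (v - w) (v - w) = hform A v v - hform A v w - hform A w v + hform A w w.
Proof.
rewrite hformDl [in X in X + _]hformDr [in X in _ + X]hformDr.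
by rewrite [hform _ (- w) v]hformNl [hform _ v (- w)]hformNr hformNl hformNr opprK addrA.
Qed.

End HermitianForms.

(* The complex numbers are kept abstract, with [toC] for [x%:C] and [re] for the
   real part, so that unification never unfolds the arithmetic of [R[i]]. *)
Section Spectral.
Set Implicit Arguments.
Unset Strict Implicit.
Context {R : realType} {C : numClosedFieldType}.
Variables (toC : {rmorphism R -> C}) (re : C -> R).
Hypothesis toC_le : forall x y, (toC x <= toC y) = (x <= y).
Hypothesis toC_conj : forall x, Num.conj (toC x) = toC x.
Hypothesis toC_re : forall z, z \is Num.real -> toC (re z) = z.
Hypothesis re_toC : forall x, re (toC x) = x.

(** * Unitary diagonalisation of hermitian matrices *)

Lemma toC_ge0 x : (0 <= toC x) = (0 <= x).
Proof. by rewrite -(rmorph0 toC) toC_le. Qed.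

Definition specmx n (P : 'M[C]_n) (d : 'I_n -> R) : 'M[C]_n :=
  adjm P *m diag_mx (\row_j toC (d j)) *m P.

Lemma adj_specmx n (P : 'M[C]_n) d : adjm (specmx P d) = specmx P d.
Proof.
rewrite /specmx !adjm_mul adjmK mulmxA; congr (_ *m _ *m _).
apply/matrixP => i j; rewrite adjmE !mxE eq_sym.
by case: eqP => [->|_]; rewrite ?mulr1n ?mulr0n ?conjC0 ?toC_conj.
Qed.

Lemma specmxM n (P : 'M[C]_n) d e : unitarym P ->
  specmx P d *m specmx P e = specmx P (fun j => d j * e j).
Proof.
move=> hP; rewrite /specmx -!mulmxA (mulmxA P) hP mul1mx.
congr (_ *m _); rewrite mulmxA mulmx_diag; congr (diag_mx _ *m _).
by apply/rowP => j; rewrite !mxE rmorphM.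
Qed.

Lemma specmx_unitary1 n (P : 'M[C]_n) : unitarym P -> specmx P (fun=> 1) = 1%:M.
Proof.
move=> hP; rewrite /specmx (_ : diag_mx _ = 1%:M) ?mulmx1 ?unitary_adjl //.
by apply/matrixP => i j; rewrite !mxE rmorph1.
Qed.

Lemma hform_specmx n (P : 'M[C]_n) d v w :
  hform (specmx P d) v w =
  \sum_j toC (d j) * ((v *m adjm P) 0 j * Num.conj ((w *m adjm P) 0 j)).
Proof.
rewrite !hformE /specmx !mulmxA -(mulmxA _ P) mxE; apply: eq_bigr => j _.
have -> : P *m adjm w = adjm (w *m adjm P) by rewrite adjm_mul adjmK.
by rewrite adjmE mul_mx_diag mulrA [toC _ * _]mulrC [in LHS]mxE [X in _ * X * _]mxE.
Qed.

Lemma mxtrace_specmx n (P : 'M[C]_n) d : unitarym P ->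
  \tr (specmx P d) = \sum_j toC (d j).
Proof.
move=> hP; rewrite /specmx mxtrace_mulC mulmxA hP mul1mx mxtrace_diag.
by apply: eq_bigr => j _; rewrite mxE.
Qed.

Lemma row_mul_specmx n (P : 'M[C]_n) d j : unitarym P ->
  row j P *m specmx P d = toC (d j) *: row j P.
Proof.
move=> hP; rewrite /specmx !mulmxA -row_mul hP.
apply/rowP => l; rewrite !mxE (bigD1 j) //= big1 => [|a nja].
  by rewrite mul_mx_diag !mxE eqxx mul1r addr0.
by rewrite mul_mx_diag !mxE eq_sym (negPf nja) !mul0r.
Qed.

Lemma hform1_row_unitary n (P : 'M[C]_n) j : unitarym P ->
  hform 1%:M (row j P) (row j P) = 1.
Proof.
move=> hP; have /matrixP/(_ j j) := hP; rewrite !mxE eqxx => {}hP; rewrite -[RHS]hP.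
by rewrite !hformE mulmx1 mxE; apply: eq_bigr => a _; rewrite !mxE.
Qed.

Lemma psd_specmx n (P : 'M[C]_n) d : (forall j, 0 <= d j) -> psdm (specmx P d).
Proof.
move=> d0; split=> [|v]; first exact: adj_specmx.
rewrite -hformE hform_specmx sumr_ge0 // => j _.
by rewrite mulr_ge0 ?mul_conjC_ge0 // toC_ge0.
Qed.

Lemma herm_specmxE n (A : 'M[C]_n) : adjm A = A ->
  unitarym (spectralmx A) /\
  A = specmx (spectralmx A) (fun j => re (spectral_diag A 0 j)) /\
  (forall j, spectral_diag A 0 j = toC (re (spectral_diag A 0 j))).
Proof.
move=> hA; have Ah : A \is hermsymmx.
  by apply/is_hermitianmxP; rewrite expr0 scale1r -{1}hA /adjm map_trmx.
have /unitarymxP uP := spectral_unitarymx A.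
have uP' : unitarym (spectralmx A) by rewrite /unitarym /adjm map_trmx.
have /mxOverP dr := hermitian_spectral_diag_real Ah.
have dE j : spectral_diag A 0 j = toC (re (spectral_diag A 0 j)).
  by rewrite toC_re.
split=> //; split=> //.
have /orthomx_spectralP {1}-> := hermitian_normalmx Ah.
rewrite (invmx_unitary (spectral_unitarymx A)) -map_trmx -/(adjm _) /specmx.
by congr (_ *m diag_mx _ *m _); apply/rowP => j; rewrite mxE -dE.
Qed.

Lemma psd_spectral n (A : 'M[C]_n) : psdm A ->
  exists (P : 'M[C]_n) (d : 'I_n -> R), [/\ unitarym P, forall j, 0 <= d j & A = specmx P d].
Proof.
move=> pA; have [uP [AE _]] := herm_specmxE (psd_adj pA).
exists (spectralmx A), (fun j => re (spectral_diag A 0 j)); split=> // j.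
have := psd_hform_ge0 (row j (spectralmx A)) pA.
rewrite {1}AE -{1}[specmx _ _]mulmx1 -hform_mull row_mul_specmx // hformZl.
by rewrite hform1_row_unitary // mulr1 toC_ge0.
Qed.

(** * Real powers of positive semidefinite matrices *)

Definition eigp (z : C) (s : R) : C := if z == 0 then 0 else toC (powR (re z) s).

(* Sealed, as is [hform]: unification would otherwise unfold the spectral
   decomposition whenever two powers are compared. Over [R[i]] this is [mxpow]. *)
Fact mpow_key : unit. Proof. by []. Qed.
Definition mpow n : 'M[C]_n -> R -> 'M[C]_n := locked_with mpow_key (fun A s =>
  invmx (spectralmx A) *m diag_mx (\row_j eigp (spectral_diag A 0 j) s) *m spectralmx A).

(** Differs from [powR] only at [x = 0], [s = 0], where [powR] is 1. With the value 0 there,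
    exponents add without restriction and [mpow A 0] is the support projection of [A]. *)
Definition supp_powR (x s : R) : R := if x == 0 then 0 else powR x s.

Lemma supp_powR_ge0 x s : 0 <= supp_powR x s.
Proof. by rewrite /supp_powR; case: eqP => // _; rewrite powR_ge0. Qed.

Lemma supp_powRD x s t : 0 <= x -> supp_powR x (s + t) = supp_powR x s * supp_powR x t.
Proof.
move=> x0; rewrite /supp_powR; case: eqP => [_|/eqP nx]; first by rewrite mul0r.
by rewrite powRD // nx implybT.
Qed.

Lemma supp_powR1 x : 0 <= x -> supp_powR x 1 = x.
Proof. by move=> x0; rewrite /supp_powR; case: eqP => [->//|_]; rewrite powRr1. Qed.

Lemma supp_powRM x y s : 0 <= x -> 0 <= y ->
  supp_powR (x * y) s = supp_powR x s * supp_powR y s.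
Proof.
move=> x0 y0; rewrite /supp_powR mulf_eq0; case: eqP => /= [_|_]; rewrite ?mul0r //.
by case: eqP => _; rewrite ?mulr0 // powRM.
Qed.

Lemma eigp_toC x s : eigp (toC x) s = toC (supp_powR x s).
Proof.
by rewrite /eigp fmorph_eq0 re_toC /supp_powR; case: eqP; rewrite ?rmorph0.
Qed.

(* Functional calculus is independent of the diagonalisation: an intertwiner of
   two diagonal matrices has entries only where the eigenvalues agree. *)
Lemma diag_intertwine n (W : 'M[C]_n) (d e : 'I_n -> R) (f : R -> R) :
  diag_mx (\row_j toC (d j)) *m W = W *m diag_mx (\row_j toC (e j)) ->
  diag_mx (\row_j toC (f (d j))) *m W = W *m diag_mx (\row_j toC (f (e j))).
Proof.
move=> /matrixP h; apply/matrixP => i j; have := h i j.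
rewrite !mul_diag_mx !mul_mx_diag !mxE => /eqP.
rewrite mulrC -subr_eq0 -mulrBr mulf_eq0 => /orP[/eqP->|]; first by rewrite mulr0 mul0r.
by rewrite subr_eq0 (inj_eq (fmorph_inj toC)) => /eqP->; rewrite mulrC.
Qed.

(** In the two eigenbases [W] becomes [V = P W Q*], which intertwines the diagonal matrices. The
    case [W = 1] gives independence of the diagonalisation, the case [P = Q] commutation with
    powers. *)
Lemma specmx_intertwine n (P Q W : 'M[C]_n) d e (f : R -> R) :
  unitarym P -> unitarym Q ->
  specmx P d *m W = W *m specmx Q e ->
  specmx P (f \o d) *m W = W *m specmx Q (f \o e).
Proof.
move=> hP hQ h; pose V := P *m W *m adjm Q.
have VE (D E : 'M[C]_n) : (adjm P *m D *m P) *m W = W *m (adjm Q *m E *m Q) <->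
    D *m V = V *m E.
  rewrite /V; split=> [/(congr1 (fun X => P *m X *m adjm Q))|/(congr1 (fun X => adjm P *m X *m Q))].
    by rewrite -!mulmxA hQ mulmx1 !mulmxA hP mul1mx.
  by rewrite -!mulmxA (unitary_adjl hQ) mulmx1 !mulmxA (unitary_adjl hP) mul1mx.
by apply/VE; apply: diag_intertwine; apply/VE.
Qed.

Lemma mpow_specmx n (P : 'M[C]_n) d s : unitarym P ->
  mpow (specmx P d) s = specmx P (fun j => supp_powR (d j) s).
Proof.
move=> hP; set A := specmx P d.
have [hS [AE dE]] := herm_specmxE (adj_specmx P d).
rewrite -/A in hS AE dE.
have -> : mpow A s =
    specmx (spectralmx A) (supp_powR^~ s \o (fun j => re (spectral_diag A 0 j))).
  rewrite /mpow unlock (invmx_unitary (spectral_unitarymx A)) -map_trmx -/(adjm _) /specmx.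
  congr (_ *m diag_mx _ *m _); apply/rowP => j.
  by rewrite !mxE [in LHS]dE eigp_toC.
(* The identity intertwines the given diagonalisation with the one chosen by [spectralmx]. *)
rewrite -[LHS]mulmx1 -[RHS]mul1mx; apply: specmx_intertwine => //.
by rewrite mulmx1 mul1mx -AE.
Qed.

Lemma psd_mpow n (A : 'M[C]_n) s : psdm A -> psdm (mpow A s).
Proof.
move=> /psd_spectral[P [d [hP d0 ->]]]; rewrite (mpow_specmx _ _ hP).
by apply: psd_specmx => j; exact: supp_powR_ge0.
Qed.

Lemma mpowD n (A : 'M[C]_n) s t : psdm A ->
  mpow A s *m mpow A t = mpow A (s + t).
Proof.
move=> /psd_spectral[P [d [hP d0 ->]]]; rewrite !(mpow_specmx _ _ hP) (specmxM _ _ hP).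
by congr specmx; apply/funext => j; rewrite supp_powRD.
Qed.

Lemma mpow1 n (A : 'M[C]_n) : psdm A -> mpow A 1 = A.
Proof.
move=> /psd_spectral[P [d [hP d0 ->]]]; rewrite !(mpow_specmx _ _ hP).
by congr specmx; apply/funext => j; rewrite supp_powR1.
Qed.

Lemma mpow_mul1 n (A : 'M[C]_n) s : psdm A -> mpow A s *m A = mpow A (s + 1).
Proof. by move=> pA; rewrite -(mpowD s 1 pA) mpow1. Qed.

Lemma mpow_comm n (A W : 'M[C]_n) s : psdm A ->
  A *m W = W *m A -> mpow A s *m W = W *m mpow A s.
Proof.
move=> /psd_spectral[P [d [hP d0 ->]]]; rewrite !(mpow_specmx _ _ hP) => h.
exact: (specmx_intertwine (supp_powR^~ s) hP hP h).
Qed.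

Lemma adj_mpow n (A : 'M[C]_n) s : psdm A -> adjm (mpow A s) = mpow A s.
Proof. by move=> pA; apply: psd_adj; exact: psd_mpow. Qed.

(** * Operator and trace inequalities for powers *)

Lemma mpow0_le1 n (A : 'M[C]_n) : psdm A -> lemx (mpow A 0) 1%:M.
Proof.
move=> /psd_spectral[P [d [hP d0 ->]]] v; rewrite !(mpow_specmx _ _ hP).
rewrite -(specmx_unitary1 hP) !hform_specmx; apply: ler_sum => j _.
rewrite ler_wpM2r ?mul_conjC_ge0 // toC_le /supp_powR.
by case: eqP => // _; rewrite powRr0.
Qed.

Lemma psd_le_mxtrace n (A : 'M[C]_n) : psdm A -> lemx A ((\tr A) *: 1%:M).
Proof.
move=> /psd_spectral[P [d [hP d0 ->]]] v.
rewrite hformZ -(specmx_unitary1 hP) !hform_specmx mulr_sumr; apply: ler_sum => j _.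
rewrite rmorph1 mul1r ler_wpM2r ?mul_conjC_ge0 // mxtrace_specmx //.
by rewrite (bigD1 j) //= lerDl sumr_ge0 // => a _; rewrite toC_ge0.
Qed.

Lemma psd_mxtrace_ge0 n (A : 'M[C]_n) : psdm A -> 0 <= \tr A.
Proof.
move=> /psd_spectral[P [d [hP d0 ->]]]; rewrite mxtrace_specmx // sumr_ge0 // => j _.
by rewrite toC_ge0.
Qed.

Lemma psd_hform_eq0 n (A : 'M[C]_n) v : psdm A ->
  hform A v v = 0 -> v *m A = 0.
Proof.
move=> pA; rewrite -[A in hform A](mpow1 pA).
have -> : 1 = 2^-1 + 2^-1 :> R by lra.
rewrite -mpowD // => h.
have /hform1_eq0 h0 : hform 1%:M (v *m mpow A 2^-1) (v *m mpow A 2^-1) = 0.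
  by rewrite hform_mull hform_mulr mulmx1 adj_mpow.
rewrite -[A](mpow1 pA) (_ : 1 = 2^-1 + 2^-1); last by lra.
by rewrite -mpowD // mulmxA h0 mul0mx.
Qed.

Lemma mxtrace_sqrt_mono n (A B : 'M[C]_n) : psdm A -> psdm B ->
  lemx A B -> \tr (mpow A 2^-1) <= \tr (mpow B 2^-1).
Proof.
move=> pA pB AB; have [P [d [hP d0 BE]]] := psd_spectral pB.
rewrite !(mxtrace_unitary _ hP); apply: ler_sum => j _.
set e := row j P; have e1 : hform 1%:M e e = 1 by exact: hform1_row_unitary.
have BsE : hform (mpow B 2^-1) e e = toC (supp_powR (d j) 2^-1).
  rewrite BE mpow_specmx // -[specmx _ _]mulmx1 -hform_mull row_mul_specmx //.
  by rewrite hformZl e1 mulr1.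
have BE2 : hform B e e = hform (mpow B 2^-1) e e ^+ 2.
  rewrite BsE BE -[specmx _ _]mulmx1 -hform_mull row_mul_specmx // hformZl e1 mulr1.
  rewrite -rmorphXn /= expr2 -supp_powRD //; congr (toC _).
  by rewrite -[LHS]supp_powR1 //; congr supp_powR; lra.
have [a0 b0] : 0 <= hform (mpow A 2^-1) e e /\ 0 <= hform (mpow B 2^-1) e e.
  by split; apply/psd_hform_ge0/psd_mpow.
have key : hform (mpow A 2^-1) e e ^+ 2 <= hform (mpow B 2^-1) e e ^+ 2; last first.
  exact: (le_of_sqr _ _ _ a0 b0 key).
apply: (@le_trans _ _ (hform B e e)); last by rewrite BE2.
apply: le_trans (AB e).
have := cauchy_schwarz (e *m mpow A 2^-1) e.
rewrite e1 mulr1 !hform_mull hform_mulr (adj_mpow _ pA) !mulmx1 (mpowD _ _ pA).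
have -> : 2^-1 + 2^-1 = 1 :> R by lra.
by rewrite (mpow1 pA) (ger0_norm a0).
Qed.


(** Expand the squared norm of [v X^(p/2) - w X^(q/2)]. *)
Lemma mpow_amgm n (X : 'M[C]_n) p q m v w : psdm X -> p + q = m + m ->
  hform (mpow X m) v w + hform (mpow X m) w v <=
  hform (mpow X p) v v + hform (mpow X q) w w.
Proof.
move=> pX pqm.
have := hform1_ge0 (v *m mpow X (p / 2) - w *m mpow X (q / 2)).
rewrite hformB2 !hform_mul2 !mulmx1 !(adj_mpow _ pX) !(mpowD _ _ pX).
have -> : p / 2 + p / 2 = p by lra.
have -> : q / 2 + q / 2 = q by lra.
have -> : p / 2 + q / 2 = m by lra.
have -> : q / 2 + p / 2 = m by lra.
exact: le_of_subr_sub.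
Qed.

Lemma mulmx_scale1 n (c : C) (A B : 'M[C]_n) :
  A *m (c *: 1%:M) *m B = c *: (A *m B).
Proof. by rewrite -scalemxAr mulmx1 -scalemxAl. Qed.

(** Conjugate [X^(s-1) <= Tr(X^(s-1)) 1] by [X^(1/2)]. It is used to place the support of [E(X^s)]
    inside that of [E(X)]. *)
Lemma mpow_le_scale n (X : 'M[C]_n) s : psdm X ->
  lemx (mpow X s) (\tr (mpow X (s - 1)) *: X).
Proof.
move=> pX; have := lemx_congr (mpow X 2^-1) (psd_le_mxtrace (psd_mpow (s - 1) pX)).
rewrite (adj_mpow _ pX) mulmx_scale1 !(mpowD _ _ pX).
have -> : 2^-1 + (s - 1) + 2^-1 = s by lra.
have -> : 2^-1 + 2^-1 = 1 :> R by lra.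
by rewrite (mpow1 pX).
Qed.

(* Tested on an eigenvector [y] of [K = Z^(-m/2) M Z^(-m/2)], the hypothesis with
   [v = y Z^(-m/2)] and [w = y Z^(p - 3m/2)] bounds the eigenvalue by [1]. *)
Lemma lemx_mpow_amgm n (M Z : 'M[C]_n) p q m : psdm M -> psdm Z ->
  p + q = m + m -> mpow Z 0 *m M = M ->
  (forall v w, hform M v w + hform M w v <=
               hform (mpow Z p) v v + hform (mpow Z q) w w) ->
  lemx M (mpow Z m).
Proof.
move=> pM pZ pqm supM h.
have supM' : M *m mpow Z 0 = M.
  by rewrite -[RHS](psd_adj pM) -[in RHS]supM adjm_mul (psd_adj pM) (adj_mpow _ pZ).
pose a := - (m / 2).
pose K := mpow Z a *m M *m mpow Z a.
have pK : psdm K by have := psd_congr (mpow Z a) pM; rewrite (adj_mpow _ pZ).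
have K1 : lemx K 1%:M.
  have [P [d [hP d0 KE]]] := psd_spectral pK.
  suff d1 j : d j <= 1.
    move=> v; rewrite KE -(specmx_unitary1 hP) !hform_specmx; apply: ler_sum => j _.
    by apply: ler_wpM2r; [rewrite mul_conjC_ge0|rewrite toC_le].
  have [->|dj0] := eqVneq (d j) 0; first exact: ler01.
  set y := row j P.
  have yK : y *m K = toC (d j)  *: y by rewrite KE; exact: row_mul_specmx.
  have y1 : hform 1%:M y y = 1 by exact: hform1_row_unitary.
  set c := hform (mpow Z (p - m)) y y.
  (* If [c] vanished, [y] would be killed by [Z^(p-m)], hence by [Z^a] and by [K], against
     [d j != 0]. *)
  have c0 : 0 < c.
    rewrite lt_def (psd_hform_ge0 _ (psd_mpow _ pZ)) andbT; apply/eqP => c0.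
    have yZ : y *m mpow Z (p - m) = 0 by exact: psd_hform_eq0 (psd_mpow _ pZ) c0.
    have yZa : y *m mpow Z a = 0.
      have -> : a = (p - m) + (a - (p - m)) by lra.
      by rewrite -(mpowD _ _ pZ) mulmxA yZ mul0mx.
    have : toC (d j)  *: y = 0 by rewrite -yK /K !mulmxA yZa !mul0mx.
    move=> /(congr1 (fun x => hform 1%:M x y)); rewrite hformZl y1 mulr1.
    rewrite (_ : hform _ 0 y = 0); last by rewrite hformE !mul0mx mxE.
    by move=> /eqP; rewrite fmorph_eq0 (negPf dj0).
  have := h (y *m mpow Z a) (y *m mpow Z (p - m + a)).
  rewrite !hform_mul2 !(adj_mpow _ pZ).
  have E1 : mpow Z a *m M *m mpow Z (p - m + a) = K *m mpow Z (p - m).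
    by rewrite /K -[RHS]mulmxA (mpowD _ _ pZ) [a + _]addrC.
  have E2 : mpow Z (p - m + a) *m M *m mpow Z a = mpow Z (p - m) *m adjm K.
    by rewrite (psd_adj pK) /K !mulmxA (mpowD _ _ pZ).
  have E3 : mpow Z a *m mpow Z p *m mpow Z a = mpow Z (p - m).
    by rewrite !(mpowD _ _ pZ); congr mpow; rewrite /a; lra.
  have E4 : mpow Z (p - m + a) *m mpow Z q *m mpow Z (p - m + a) = mpow Z (p - m).
    by rewrite !(mpowD _ _ pZ); congr mpow; rewrite /a; lra.
  (* Both terms on the left become [d j * c] and both on the right become [c]. *)
  rewrite E1 E2 E3 E4 -hform_mull -hform_mulr yK hformZl hformZr.
  rewrite toC_conj -/c -mulrDr.
  have c2 : 0 < c + c by exact: addr_gt0.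
  by rewrite ger_pMl // -(rmorph1 toC) toC_le.
(* Conjugating [K <= 1] by [Z^(m/2)] returns [M], since [M] lives on the support of [Z]. *)
have := lemx_congr (mpow Z (m / 2)) K1.
rewrite (adj_mpow _ pZ) mulmx1 (mpowD _ _ pZ).
have -> : m / 2 + m / 2 = m by lra.
suff -> : mpow Z (m / 2) *m K *m mpow Z (m / 2) = M by [].
rewrite /K; rewrite !mulmxA (mpowD _ _ pZ) -!mulmxA (mpowD _ _ pZ) mulmxA.
have -> : m / 2 + a = 0 by rewrite /a; lra.
have -> : a + m / 2 = 0 by rewrite /a; lra.
by rewrite supM supM'.
Qed.

(** The matrices [F j] are the spectral projections and do not depend on [s]: the exponent enters
    through scalar coefficients only, which gives continuity in it. *)
Lemma mpow_sum n (X : 'M[C]_n) : psdm X ->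
  exists (F : 'I_n -> 'M[C]_n) (d : 'I_n -> R), (forall j, psdm (F j)) /\
    forall s, mpow X s = \sum_j toC (supp_powR (d j) s) *: F j.
Proof.
move=> /psd_spectral[P [d [hP d0 ->]]].
exists (fun j => specmx P (fun i => (i == j)%:R)), d; split=> [j|s].
  by apply: psd_specmx => i; rewrite ler0n.
rewrite (mpow_specmx _ _ hP) /specmx diag_mx_sum_delta mulmx_sumr mulmx_suml.
apply: eq_bigr => j _; rewrite mxE -scalemxAr -scalemxAl; congr (_ *: (_ *m _ *m _)).
apply/matrixP => a b; rewrite !mxE.
case: (eqVneq a b) => [<-|nab]; first by rewrite andbb mulr1n rmorph_nat.
by rewrite mulr0n; case: (a =P j) nab => //= ->; rewrite eq_sym => /negPf->.
Qed.

(** Continuous at exponent 0 as well: for [x = 0] the function vanishes identically, otherwise it is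
    an exponential. *)
Lemma continuous_supp_powR (x : R) : continuous (supp_powR x).
Proof.
have [->|nx] := eqVneq x 0 => s.
  rewrite (_ : supp_powR 0 = fun=> 0); first exact: cvg_cst.
  by apply/funext => t; rewrite /supp_powR eqxx.
have -> : supp_powR x = fun t => expR (t * ln x).
  by apply/funext => t; rewrite /supp_powR /powR (negPf nx).
apply: (@cvg_comp _ _ _ (fun t : R => t * ln x) expR _ (nbhs (s * ln x)));
  last exact: continuous_expR.
by apply: cvgM; [exact: cvg_id|exact: cvg_cst].
Qed.

(** * Covariant expectations and operator Jensen inequalities *)

Definition commutant N (T : Type) (U : T -> 'M[C]_N) (Z : 'M[C]_N) : Prop :=
  forall g, Z *m U g = U g *m Z.

(* The properties of [E_{A_n}] that the argument uses; [D] bounds the rank. *)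
Record covariant_expectation N (T : Type) (U : T -> 'M[C]_N) (D : nat)
    (E : 'M[C]_N -> 'M[C]_N) : Prop := CovariantExpectation {
  cexpD : forall X Y, E (X + Y) = E X + E Y;
  cexpZ : forall c X, E (c *: X) = c *: E X;
  cexp_le : forall X Y, lemx X Y -> lemx (E X) (E Y);
  cexp_psd : forall X, psdm X -> psdm (E X);
  cexp_amgm : forall M A B,
    (forall v w, hform M v w + hform M w v <= hform A v v + hform B w w) ->
    forall v w, hform (E M) v w + hform (E M) w v <= hform (E A) v v + hform (E B) w w;
  cexpM : forall Z X W, commutant U Z -> commutant U W ->
    E (Z *m X *m W) = Z *m E X *m W;
  cexp_fix : forall X, commutant U X -> E X = X;
  cexp_comm : forall X, commutant U (E X);
  cexp_mxtrace : forall X, \tr (E X) = \tr X;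
  cexp_rank : forall e : 'rV[C]_N, (\rank (E (adjm e *m e)) <= D)%N }.

Section CovariantExpectation.
Variables (N : nat) (T : Type) (U : T -> 'M[C]_N) (D : nat) (E : 'M[C]_N -> 'M[C]_N).
Hypothesis hE : covariant_expectation U D E.

Lemma commutant1 : commutant U 1%:M.
Proof. by move=> g; rewrite mul1mx mulmx1. Qed.

Lemma commutant_mpow Z s : psdm Z -> commutant U Z -> commutant U (mpow Z s).
Proof. by move=> pZ cZ g; exact: mpow_comm. Qed.

Lemma cexp0 : E 0 = 0.
Proof. by rewrite -(scale0r (0 : 'M[C]_N)) (cexpZ hE) !scale0r. Qed.

Lemma cexp_sum (J : finType) (F : J -> 'M[C]_N) : E (\sum_j F j) = \sum_j E (F j).
Proof. by rewrite (big_morph E (cexpD hE) cexp0). Qed.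

(** [E(X^s)] is at most a multiple of [E(X)], so its form vanishes on the kernel of [E(X)]; a
    positive matrix annihilates the vectors on which its form vanishes. *)
Lemma cexp_supp X s : psdm X -> mpow (E X) 0 *m E (mpow X s) = E (mpow X s).
Proof.
move=> pX; have pZ := cexp_psd hE pX; have pM := cexp_psd hE (psd_mpow s pX).
set Z := E X in pZ *; set M := E _ in pM *.
have Z0Z : mpow Z 0 *m Z = Z.
  by rewrite mpow_mul1 // add0r mpow1.
have QM (v : 'rV[C]_N) : (v *m (1%:M - mpow Z 0)) *m M = 0.
  set w := v *m _; apply: psd_hform_eq0 => //; apply/eqP; rewrite eq_le.
  rewrite psd_hform_ge0 // andbT.
  have := cexp_le hE (mpow_le_scale s pX) w; rewrite (cexpZ hE) hformZ -/Z -/M.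
  suff -> : hform Z w w = 0 by rewrite mulr0.
  by rewrite /w hform_mull mulmxBl mul1mx Z0Z subrr hformE mulmx0 mul0mx mxE.
apply/eqP; rewrite eq_sym -subr_eq0 -[X in X - _]mul1mx -mulmxBl; apply/eqP/row_matrixP => i.
by rewrite row_mul rowE QM row0.
Qed.

Let good X t := lemx (E (mpow X t)) (mpow (E X) t).

(** Apply [E] to [X^0 <= 1], then compress to the support of [E(X)], which contains that of
    [E(X^0)]. *)
Lemma cexp_jensen0 X : psdm X -> good X 0.
Proof.
move=> pX; have pZ := cexp_psd hE pX; have pM := cexp_psd hE (psd_mpow 0 pX).
have sM := cexp_supp 0 pX; rewrite /good.
have sM' : E (mpow X 0) *m mpow (E X) 0 = E (mpow X 0).
  by rewrite -[RHS](psd_adj pM) -[in RHS]sM adjm_mul (psd_adj pM) (adj_mpow _ pZ).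
have := lemx_congr (mpow (E X) 0) (cexp_le hE (mpow0_le1 pX)).
rewrite (adj_mpow _ pZ) sM sM' (cexp_fix hE commutant1) mulmx1 (mpowD _ _ pZ).
by rewrite addr0.
Qed.

Lemma cexp_jensen1 X : psdm X -> good X 1.
Proof. by move=> pX; rewrite /good !mpow1 //; exact: cexp_psd hE _ pX. Qed.

(** [E] preserves the inequality of [mpow_amgm], and goodness of [p] and [q] replaces its right side
    by powers of [E(X)]. This is the hypothesis of [lemx_mpow_amgm]. *)
Lemma cexp_jensen_mid X p q m : psdm X -> p + q = m + m ->
  good X p -> good X q -> good X m.
Proof.
move=> pX pqm gp gq; have pZ := cexp_psd hE pX.
apply: (lemx_mpow_amgm (cexp_psd hE (psd_mpow m pX)) pZ pqm (cexp_supp m pX)) => v w.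
apply: le_trans (lerD (gp v) (gq w)).
by apply: (cexp_amgm hE) => a b; exact: mpow_amgm.
Qed.

(** Bisection of [[0, 1]], always keeping the half that contains [t]. *)
Lemma cexp_jensen_dyadic X t k : psdm X -> 0 <= t <= 1 ->
  exists a b, [/\ a <= t <= b, b - a = 2^-1 ^+ k, good X a & good X b].
Proof.
move=> pX t01; elim: k => [|k [a [b [/andP[at_ tb] ba ga gb]]]].
  by exists 0, 1; rewrite subr0 expr0; split=> //; [exact: cexp_jensen0|exact: cexp_jensen1].
pose m := (a + b) / 2.
have gm : good X m by apply: (cexp_jensen_mid pX _ ga gb); rewrite /m; lra.
have [tm|mt] := leP t m.
  by exists a, m; split=> //; rewrite ?at_ ?tm // exprS -ba /m; lra.
by exists m, b; split=> //; rewrite ?(ltW mt) ?tb // exprS -ba /m; lra.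
Qed.

(** The defect of the Jensen inequality on a fixed vector is a real combination of functions
    [supp_powR x], by the spectral resolutions of [X] and [E X]. *)
Lemma cexp_jensen_continuous X v : psdm X -> exists f : R -> R, continuous f /\
  forall t, hform (mpow (E X) t) v v - hform (E (mpow X t)) v v = toC (f t).
Proof.
move=> pX; have [F [d [pF XE]]] := mpow_sum pX.
have [H [e [pH ZE]]] := mpow_sum (cexp_psd hE pX).
exists (fun t => \sum_j supp_powR (e j) t * re (hform (H j) v v) -
                 \sum_j supp_powR (d j) t * re (hform (E (F j)) v v)); split=> [t|t].
  have cs (a b : 'I_N -> R) : continuous (fun t : R => \sum_j supp_powR (a j) t * b j).
    move=> x; elim: (index_enum _) => [|j s IHs].
      by under eq_fun do rewrite big_nil; exact: cvg_cst.
    under eq_fun do rewrite big_cons; apply: cvgD; last exact: IHs.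
    by apply: cvgM; [exact: continuous_supp_powR|exact: cvg_cst].
  by apply: cvgB; exact: cs.
have real_sum (a : 'I_N -> R) (Y : 'I_N -> 'M[C]_N) : (forall j, psdm (Y j)) ->
    \sum_j toC (a j) * hform (Y j) v v = toC (\sum_j a j * re (hform (Y j) v v)).
  move=> pY; rewrite rmorph_sum /=; apply: eq_bigr => j _.
  by rewrite rmorphM /= toC_re // ger0_real // psd_hform_ge0.
rewrite XE ZE cexp_sum !hform_sum rmorphB /= -!real_sum //; last first.
  by move=> j; exact: (cexp_psd hE).
by congr (_ - _); apply: eq_bigr => j _; rewrite ?(cexpZ hE) hformZ.
Qed.

(* The set of good exponents contains [0] and [1], is closed under midpoints and,
   both sides being finite sums of exponentials in [t], topologically closed. *)
Lemma cexp_jensen X t : psdm X -> 0 <= t <= 1 -> good X t.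
Proof.
move=> pX t01 v; have [f [cf fE]] := cexp_jensen_continuous v pX.
have gf a : good X a -> 0 <= f a.
  by move=> ga; rewrite -toC_ge0 -fE subr_ge0; exact: ga.
rewrite -subr_ge0 fE toC_ge0 leNgt; apply/negP => ft.
have /nbhs_ballP[eps /= eps0 heps] : \forall x \near t, f x < 0.
  by have /cvgr_lt/(_ _ ft) := cf t.
have [k hk] : exists k, 2^-1 ^+ k < eps.
  have : ((fun k => 2^-1 ^+ k : R) @ \oo --> (0 : R))%classic.
    by apply: cvg_expr; rewrite ger0_norm; lra.
  by move=> /cvgr_lt/(_ _ eps0)[k _ hk]; exists k; exact: hk (leqnn k).
have [a [b [/andP[at_ tb] ba ga _]]] := cexp_jensen_dyadic k pX t01.
have := gf _ ga; rewrite leNgt => /negP; apply; apply: heps.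
rewrite /ball /= ger0_norm ?subr_ge0 //; lra.
Qed.

(** Take exponents [1 + r] and [1 - r] with mean 1, and [w = v E(X)^r]. With [h = v E(X)^(1+r) v*],
    each cross term equals [h], and the Jensen inequality at [1 - r] bounds the [w] term by [h]; so
    [2 h <= v E(X^(1+r)) v* + h]. *)
Lemma cexp_jensen_convex X r : psdm X -> 0 <= r <= 1 ->
  lemx (mpow (E X) (1 + r)) (E (mpow X (1 + r))).
Proof.
move=> pX r01 v; have pZ := cexp_psd hE pX.
have r01' : 0 <= 1 - r <= 1 by move: r01 => /andP[]; lra.
set w := v *m mpow (E X) r.
have pq : (1 + r) + (1 - r) = 1 + 1 :> R by lra.
have am := cexp_amgm hE (fun a b => mpow_amgm a b pX pq) v w.
have := le_trans am (lerD (lexx _) (cexp_jensen pX r01' w)).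
have h1 : hform (E X) v w = hform (mpow (E X) (1 + r)) v v.
  by rewrite hform_mulr (adj_mpow _ pZ) -(mpowD 1 r pZ) (mpow1 pZ).
have h2 : hform (E X) w v = hform (mpow (E X) (1 + r)) v v.
  by rewrite hform_mull addrC -(mpowD r 1 pZ) (mpow1 pZ).
have h3 : hform (mpow (E X) (1 - r)) w w = hform (mpow (E X) (1 + r)) v v.
  rewrite hform_mul2 (adj_mpow _ pZ) !(mpowD _ _ pZ); congr (hform (mpow _ _) _ _).
  by lra.
by rewrite (mpow1 pX) h1 h2 h3 lerD2r.
Qed.

(** * Rank, pinching and trace estimates for the expectation *)

Lemma mxtrace_mpow0 n (A : 'M[C]_n) : psdm A -> \tr (mpow A 0) <= (\rank A)%:R.
Proof.
move=> /psd_spectral[P [d [hP d0 ->]]].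
rewrite (mpow_specmx _ _ hP) (mxtrace_specmx _ hP).
pose S := [set j | d j != 0].
have -> : \sum_j toC (supp_powR (d j) 0) = #|S|%:R.
  rewrite -sum1_card natr_sum [RHS]big_mkcond /=; apply: eq_bigr => j _.
  rewrite inE /supp_powR; case: eqP => /= _; first exact: rmorph0.
  by rewrite powRr0 rmorph1.
rewrite ler_nat.
(* Rescaling the eigenvectors by the inverse eigenvalues makes [V A W*] the identity of size [#|S|],
   so the rank is at least [#|S|]. *)
pose W := \matrix_(i < #|S|) row (enum_val i) P.
pose V := \matrix_(i < #|S|) (toC (d (enum_val i))^-1 *: row (enum_val i) P).
apply: (@mulmx1_min_rank _ _ _ _ _ V (adjm W)).
have -> : V *m specmx P d = W.
  apply/row_matrixP => i; rewrite row_mul !rowK -scalemxAl (row_mul_specmx _ _ hP).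
  rewrite scalerA -rmorphM /= mulVf ?rmorph1 ?scale1r //.
  by have := enum_valP i; rewrite inE.
apply/matrixP => i j; have /matrixP/(_ (enum_val i) (enum_val j)) := hP.
rewrite !mxE (inj_eq enum_val_inj) => <-.
by apply: eq_bigr => l _; rewrite !mxE.
Qed.

Lemma hform_rank1 (e v w : 'rV[C]_N) :
  hform (adjm e *m e) v w = hform 1%:M v e * hform 1%:M e w.
Proof.
by rewrite !hformE !mulmx1 !mulmxA -mulmxA [LHS]mxE big_ord1.
Qed.

Lemma mxtrace_rank1 (A : 'M[C]_N) (e : 'rV[C]_N) : \tr (A *m (adjm e *m e)) = hform A e e.
Proof. by rewrite mulmxA mxtrace_mulC mulmxA hformE trace_mx11. Qed.

Lemma psd_rank1 (e : 'rV[C]_N) : psdm (adjm e *m e).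
Proof.
apply: psd_hform => [|v]; first by rewrite adjm_mul adjmK.
rewrite hform_rank1 -[hform _ v e]conjCK hform_conj adjm1.
by rewrite mulrC mul_conjC_ge0.
Qed.

(* [e G^-1 e* = \tr (G^-1 G)] because [G^-1] is covariant; the rest is
   Cauchy-Schwarz for [e G^(-1/2)] and [w G^(1/2)]. *)
Lemma cexp_rank1_pinching (e w : 'rV[C]_N) :
  `|hform 1%:M e w| ^+ 2 <= D%:R * hform (E (adjm e *m e)) w w.
Proof.
set G := E _; have pG : psdm G by apply: (cexp_psd hE); exact: psd_rank1.
have cG s : commutant U (mpow G s) by apply: commutant_mpow => //; exact: (cexp_comm hE).
have trG (Z : 'M[C]_N) : commutant U Z -> hform Z e e = \tr (Z *m G).
  move=> cZ; rewrite -mxtrace_rank1 -(cexp_mxtrace hE); congr (\tr _).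
  by rewrite -[Z *m (_ *m _)]mulmx1 (cexpM hE) ?mulmx1 //; exact: commutant1.
(* The projection [1 - G^0] is in the commutant, so its form at [e] is [Tr ((1 - G^0) G) = 0]. *)
have eG : e *m mpow G 0 = e.
  apply/eqP; rewrite eq_sym -subr_eq0; apply/eqP; apply: hform1_eq0.
  have -> : e - e *m mpow G 0 = e *m (1%:M - mpow G 0) by rewrite mulmxBr mulmx1.
  rewrite hform_mul2 mulmx1 adjmD adjmN adjm1 (adj_mpow _ pG).
  have -> : (1%:M - mpow G 0) *m (1%:M - mpow G 0) = 1%:M - mpow G 0.
    by rewrite mulmxBl mul1mx mulmxBr mulmx1 (mpowD _ _ pG) addr0 subrr subr0.
  rewrite trG; last first.
    by move=> g; rewrite mulmxBl mulmxBr (cG 0) mul1mx mulmx1.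
  by rewrite mulmxBl mul1mx (mpow_mul1 _ pG) add0r (mpow1 pG) subrr mxtrace0.
have := cauchy_schwarz (e *m mpow G (- 2^-1)) (w *m mpow G 2^-1).
rewrite !hform_mul2 !mulmx1 !(adj_mpow _ pG) !(mpowD _ _ pG).
have -> : - 2^-1 + 2^-1 = 0 :> R by lra.
have -> : 2^-1 + 2^-1 = 1 :> R by lra.
have -> : hform (mpow G 0) e w = hform 1%:M e w by rewrite -{2}eG hform_mull mulmx1.
move=> h; apply: le_trans h _; rewrite mpow1 //.
apply: ler_wpM2r; first exact: psd_hform_ge0.
rewrite trG // (mpow_mul1 _ pG) (_ : - 2^-1 + - 2^-1 + 1 = 0); last by lra.
apply: le_trans (mxtrace_mpow0 pG) _; rewrite ler_nat; exact: (cexp_rank hE).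
Qed.

Lemma cexp_mxtrace_sqrt_ge Y : psdm Y -> \tr (mpow Y 2^-1) <= \tr (mpow (E Y) 2^-1).
Proof.
move=> pY; rewrite -(cexp_mxtrace hE); apply: lemx_mxtrace; apply: cexp_jensen => //.
by lra.
Qed.

Lemma cexp_mxtrace_sqrt_le Y : psdm Y ->
  \tr (mpow (E Y) 2^-1) <= toC (Num.sqrt D%:R) * \tr (mpow Y 2^-1).
Proof.
move=> pY; have pZ := cexp_psd hE pY; set Z := E Y in pZ *.
have [P [d [hP d0 YE]]] := psd_spectral pY.
have -> : \tr (mpow Z 2^-1) = \tr (mpow Z (- 2^-1) *m Y).
  have {1}-> : 2^-1 = - 2^-1 + 1 :> R by lra.
  rewrite -(mpow_mul1 _ pZ) -[RHS](cexp_mxtrace hE); congr (\tr _).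
  rewrite -[_ *m Y]mulmx1 (cexpM hE) ?mulmx1 //; last exact: commutant1.
  by apply: commutant_mpow => //; exact: (cexp_comm hE).
rewrite !(mxtrace_unitary _ hP) mulr_sumr; apply: ler_sum => j _.
set e := row j P; have e1 : hform 1%:M e e = 1 by exact: hform1_row_unitary.
have eY : e *m Y = toC (d j) *: e by rewrite YE; exact: row_mul_specmx.
have eYs : e *m mpow Y 2^-1 = toC (supp_powR (d j) 2^-1) *: e.
  by rewrite YE (mpow_specmx _ _ hP); exact: row_mul_specmx.
rewrite -{1}(psd_adj pY) -hform_mulr eY hformZr toC_conj.
have -> : hform (mpow Y 2^-1) e e = toC (supp_powR (d j) 2^-1).
  by rewrite -[mpow Y _]mulmx1 -hform_mull eYs hformZl e1 mulr1.
set a := hform (mpow Z _) e e; set x := hform (mpow Z (-1)) e e.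
have a0 : 0 <= a by exact: psd_hform_ge0 (psd_mpow _ pZ).
have x0 : 0 <= x by exact: psd_hform_ge0 (psd_mpow _ pZ).
have ax : a ^+ 2 <= x.
  have := cauchy_schwarz (e *m mpow Z (- 2^-1)) e.
  rewrite e1 mulr1 !hform_mul2 hform_mull !mulmx1 (adj_mpow _ pZ) (mpowD _ _ pZ).
  by rewrite (_ : - 2^-1 - 2^-1 = -1) ?ger0_norm //; lra.
have dd : supp_powR (d j) 2^-1 ^+ 2 = d j.
  by rewrite expr2 -supp_powRD // (_ : 2^-1 + 2^-1 = 1) ?supp_powR1 //; lra.
(* Cauchy-Schwarz for [e] and [v Y^(1/2)], with [e Y^(1/2) = (d j)^(1/2) e]. *)
have eeY : lemx (toC (d j) *: (adjm e *m e)) Y.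
  move=> v; rewrite hformZ hform_rank1 -[hform _ v e]conjCK hform_conj adjm1.
  rewrite [_^* * _]mulrC -normCK.
  have := cauchy_schwarz e (v *m mpow Y 2^-1).
  rewrite e1 mul1r hform_mul2 hform_mulr mulmx1 mul1mx (adj_mpow _ pY) (mpowD _ _ pY).
  rewrite (_ : 2^-1 + 2^-1 = 1); last by lra.
  rewrite (mpow1 pY) -[mpow Y _]mulmx1 -hform_mull eYs hformZl normrM exprMn.
  by rewrite ger0_norm ?toC_ge0 ?supp_powR_ge0 // -rmorphXn /= dd.
(* For [w = e Z^(-1)], pinching gives [x^2 <= D w E(e* e) w*], while [d_j E(e* e) <= Z] gives
   [d_j w E(e* e) w* <= x]. Combine and divide by [x]. *)
have dx : toC (d j) * x <= D%:R.
  have [->|xn0] := eqVneq x 0; first by rewrite mulr0 ler0n.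
  have xp : 0 < x by rewrite lt_def xn0 x0.
  rewrite -(ler_pM2r xp) -mulrA.
  have := cexp_le hE eeY (e *m mpow Z (-1)); rewrite (cexpZ hE) -/Z hformZ.
  have -> : hform Z (e *m mpow Z (-1)) (e *m mpow Z (-1)) = x.
    rewrite hform_mul2 (adj_mpow _ pZ) (mpow_mul1 _ pZ) (mpowD _ _ pZ).
    by rewrite /x (_ : -1 + 1 + -1 = -1) //; lra.
  move=> h; have := cexp_rank1_pinching e (e *m mpow Z (-1)).
  rewrite hform_mulr mul1mx (adj_mpow _ pZ) -/x (ger0_norm x0) expr2 => h2.
  apply: le_trans (ler_wpM2l (ler0n _ D) h).
  by rewrite [leRHS]mulrCA; apply: ler_wpM2l h2; rewrite toC_ge0.
have s0 := supp_powR_ge0 (d j) 2^-1.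
(* After squaring: [d_j^2 a^2 <= d_j (d_j x) <= D d_j]. *)
apply: le_of_sqr.
- by apply: mulr_ge0 => //; rewrite toC_ge0.
- by apply: mulr_ge0; rewrite toC_ge0 // sqrtr_ge0.
rewrite !exprMn -!rmorphXn /= dd sqr_sqrtr ?ler0n // rmorph_nat.
rewrite rmorphXn /= expr2 -mulrA mulrC.
apply: ler_wpM2r; first by rewrite toC_ge0.
by apply: le_trans dx; apply: ler_wpM2l ax; rewrite toC_ge0.
Qed.

(** * Trace norm bounds for one expectation *)

Definition mtrn n (X : 'M[C]_n) : C := \tr (mpow (adjm X *m X) 2^-1).

Lemma gram_mpow (A B : 'M[C]_N) s r : psdm A -> psdm B ->
  adjm (mpow A s *m mpow B r) *m (mpow A s *m mpow B r) =
  mpow B r *m mpow A (s + s) *m adjm (mpow B r).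
Proof.
move=> pA pB; rewrite adjm_mul !(adj_mpow _ pA) !(adj_mpow _ pB).
by rewrite -(mpowD _ _ pA) !mulmxA.
Qed.

(** Since [B^r] is in the commutant, [E(B^r A^(2s) B^r) = B^r E(A^(2s)) B^r], and the Jensen
    inequality applies at [2s] in [[0, 1]]. *)
Lemma cexp_mtrn_ge (A B : 'M[C]_N) s r : psdm A -> psdm B -> commutant U B ->
  0 <= s <= 2^-1 -> mtrn (mpow A s *m mpow B r) <= mtrn (mpow (E A) s *m mpow B r).
Proof.
move=> pA pB cB s01; have pZ := cexp_psd hE pA.
have cBr := commutant_mpow r pB cB; have aBr := adj_mpow r pB.
rewrite /mtrn !gram_mpow //.
have pY := psd_congr (mpow B r) (psd_mpow (s + s) pA).
apply: le_trans (cexp_mxtrace_sqrt_ge pY) _.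
apply: mxtrace_sqrt_mono; first exact: (cexp_psd hE).
  exact: psd_congr (psd_mpow _ pZ).
rewrite (cexpM hE) ?aBr // -{2 4}aBr; apply: lemx_congr; apply: cexp_jensen => //.
by move: s01 => /andP[]; lra.
Qed.

(** The exponent [2s] now lies in [[1, 2]], where the Jensen inequality is reversed; the factor
    comes from [cexp_mxtrace_sqrt_le]. *)
Lemma cexp_mtrn_le (A B : 'M[C]_N) s r : psdm A -> psdm B -> commutant U B ->
  2^-1 <= s <= 1 ->
  mtrn (mpow (E A) s *m mpow B r) <= toC (Num.sqrt D%:R) * mtrn (mpow A s *m mpow B r).
Proof.
move=> pA pB cB s01; have pZ := cexp_psd hE pA.
have cBr := commutant_mpow r pB cB; have aBr := adj_mpow r pB.
rewrite /mtrn !gram_mpow //.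
have pY := psd_congr (mpow B r) (psd_mpow (s + s) pA).
apply: le_trans (cexp_mxtrace_sqrt_le pY).
apply: mxtrace_sqrt_mono; [exact: psd_congr (psd_mpow _ pZ)|exact: (cexp_psd hE)|].
rewrite (cexpM hE) ?aBr // -{2 4}aBr; apply: lemx_congr.
have -> : s + s = 1 + (s + s - 1) by lra.
by apply: cexp_jensen_convex => //; move: s01 => /andP[]; lra.
Qed.

End CovariantExpectation.

(** * Tensor products and tensor powers *)

Lemma adjm_tens m n p q (A : 'M[C]_(m, n)) (B : 'M[C]_(p, q)) :
  adjm (A *t B) = adjm A *t adjm B.
Proof. by rewrite /adjm map_mxT trmx_tens. Qed.

Lemma tens1mx1 m n : 1%:M *t 1%:M = 1%:M :> 'M[C]_(m * n).
Proof.
apply/matrixP => i j; rewrite !mxE -natrM mulnb -xpair_eqE -!surjective_pairing.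
by rewrite (inj_eq (can_inj (@mxtens_unindexK m n))).
Qed.

Lemma unitarym_tens m n (P : 'M[C]_m) (Q : 'M[C]_n) :
  unitarym P -> unitarym Q -> unitarym (P *t Q).
Proof. by move=> hP hQ; rewrite /unitarym adjm_tens tensmx_mul hP hQ tens1mx1. Qed.

(** Tensoring two diagonalisations diagonalises the product; positivity and powers of tensor
    products are read off from it. *)
Lemma specmx_tens m n (P : 'M[C]_m) (Q : 'M[C]_n) d e :
  specmx P d *t specmx Q e =
  specmx (P *t Q) (fun j => d (mxtens_unindex j).1 * e (mxtens_unindex j).2).
Proof.
rewrite /specmx adjm_tens -!tensmx_mul; congr (_ *m _ *m _).
apply/matrixP => i j; rewrite !mxE rmorphM /= -(inj_eq (can_inj (@mxtens_unindexK m n))).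
rewrite [mxtens_unindex i]surjective_pairing [mxtens_unindex j]surjective_pairing xpair_eqE /=.
by do 2!case: eqP => _; rewrite ?mulr1n ?mulr0n ?mulr0 ?mul0r.
Qed.

Lemma psdm_tens m n (A : 'M[C]_m) (B : 'M[C]_n) : psdm A -> psdm B -> psdm (A *t B).
Proof.
move=> /psd_spectral[P [d [hP d0 ->]]] /psd_spectral[Q [e [hQ e0 ->]]].
by rewrite specmx_tens; apply: psd_specmx => j; rewrite mulr_ge0.
Qed.

Lemma mpow_tens m n (A : 'M[C]_m) (B : 'M[C]_n) s : psdm A -> psdm B ->
  mpow (A *t B) s = mpow A s *t mpow B s.
Proof.
move=> /psd_spectral[P [d [hP d0 ->]]] /psd_spectral[Q [e [hQ e0 ->]]].
rewrite (mpow_specmx _ _ hP) (mpow_specmx _ _ hQ) !specmx_tens.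
rewrite (mpow_specmx _ _ (unitarym_tens hP hQ)); congr specmx; apply/funext => j.
by rewrite supp_powRM.
Qed.

Lemma mxtrace_tens m n (A : 'M[C]_m) (B : 'M[C]_n) : \tr (A *t B) = \tr A * \tr B.
Proof. by rewrite /mxtrace mulr_sum; apply: eq_bigr => i _; rewrite mxE. Qed.

Lemma mtrn_tens m n (X : 'M[C]_m) (Y : 'M[C]_n) : mtrn (X *t Y) = mtrn X * mtrn Y.
Proof.
rewrite /mtrn adjm_tens tensmx_mul mpow_tens ?mxtrace_tens //; exact: psd_gram.
Qed.

Lemma mtrn_ge0 n (X : 'M[C]_n) : 0 <= mtrn X.
Proof. by apply: psd_mxtrace_ge0; apply: psd_mpow; exact: psd_gram. Qed.

(** Inductions on tensor powers start at the first power, which is [A] itself, hence the index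
    [n.+1]. *)
Lemma psdm_ntens k (A : 'M[C]_k) n : psdm A -> psdm (ntensmx A n.+1).
Proof.
by move=> pA; elim: n => // n IHn; exact: (psdm_tens pA IHn).
Qed.

Lemma ntens_mul k (A B : 'M[C]_k) n :
  ntensmx A n.+1 *m ntensmx B n.+1 = ntensmx (A *m B) n.+1.
Proof.
elim: n => // n IHn; rewrite !ntensmxSS -IHn; exact: tensmx_mul.
Qed.

Lemma mpow_ntens k (A : 'M[C]_k) n s : psdm A ->
  mpow (ntensmx A n.+1) s = ntensmx (mpow A s) n.+1.
Proof.
move=> pA; elim: n => // n IHn; rewrite [RHS]ntensmxSS -IHn.
by apply: mpow_tens => //; exact: psdm_ntens.
Qed.

Lemma mtrn_ntens k (X : 'M[C]_k) n : mtrn (ntensmx X n.+1) = mtrn X ^+ n.+1.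
Proof. by elim: n => // n IHn; rewrite exprS -IHn; exact: mtrn_tens. Qed.

Lemma unitarym_ntens k (A : 'M[C]_k) n : unitarym A -> unitarym (ntensmx A n.+1).
Proof. by move=> uA; elim: n => // n IHn; exact: (unitarym_tens uA IHn). Qed.

(* [c x y (a, b)] counts the tensor factors contributing the entry [A a b]. *)
Lemma ntens_monomial k n : exists c : 'I_(k ^ n.+1) -> 'I_(k ^ n.+1) ->
    {ffun 'I_k * 'I_k -> 'I_n.+2},
  forall (A : 'M[C]_k) x y,
    ntensmx A n.+1 x y = \prod_p A p.1 p.2 ^+ c x y p.
Proof.
elim: n => [|n [c IHn]].
  exists (fun x y => [ffun p => inord (p == (x, y))]) => A x y.
  rewrite (bigD1 (x, y)) //= big1 => [|p /negPf np].
    by rewrite ffunE eqxx inordK // expr1 mulr1.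
  by rewrite ffunE np inordK // expr0.
pose u (x : 'I_(k * k ^ n.+1)) := mxtens_unindex x.
(* The first factor adds one to the count of its own entry; counts stay at most [n.+2], so [inord]
   leaves them unchanged. *)
exists (fun x y => [ffun p => inord ((p == ((u x).1, (u y).1)) + c (u x).2 (u y).2 p)]).
move=> A x y; rewrite ntensmxSS.
rewrite [LHS]mxE -/(u x) -/(u y) IHn.
rewrite [RHS](eq_bigr (fun p => A p.1 p.2 ^+ (p == ((u x).1, (u y).1)) *
                           A p.1 p.2 ^+ c (u x).2 (u y).2 p)); last first.
  move=> p _; rewrite -exprD [in LHS]ffunE inordK //.
  move: (ltn_ord (c (u x).2 (u y).2 p)); case: eqP => _ /= cp; first by rewrite add1n ltnS.
  by rewrite add0n; exact: leqW.
rewrite big_split /=; congr (_ * _).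
rewrite (bigD1 ((u x).1, (u y).1)) //= big1 => [|p /negPf->]; last by rewrite expr0.
by rewrite eqxx expr1 mulr1.
Qed.

End Spectral.

(** * Haar integration of complex and matrix functions *)

Section ComplexIntegral.
Set Implicit Arguments.
Unset Strict Implicit.
Context {R : realType} {G : topologicalType}.
Variables (mul : G -> G -> G) (I : (G -> R) -> R).
Hypothesis haarI : haar_integral mul I.
Local Notation C := R[i].

(** Componentwise, the form in which [unitary_rep] supplies continuity and [haar_integral] consumes
    it. *)
Definition ccont (f : G -> C) : Prop :=
  continuous (fun g => complex.Re (f g)) /\ continuous (fun g => complex.Im (f g)).

Definition cint (f : G -> C) : C :=
  Complex (I (fun g => complex.Re (f g))) (I (fun g => complex.Im (f g))).

Lemma ReD (a b : C) : complex.Re (a + b) = complex.Re a + complex.Re b.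
Proof. by case: a b => [? ?] [? ?]. Qed.
Lemma ImD (a b : C) : complex.Im (a + b) = complex.Im a + complex.Im b.
Proof. by case: a b => [? ?] [? ?]. Qed.
Lemma ReM (a b : C) :
  complex.Re (a * b) = complex.Re a * complex.Re b - complex.Im a * complex.Im b.
Proof. by case: a b => [? ?] [? ?]. Qed.
Lemma ImM (a b : C) :
  complex.Im (a * b) = complex.Re a * complex.Im b + complex.Im a * complex.Re b.
Proof. by case: a b => [? ?] [? ?]. Qed.
Lemma ReJ (a : C) : complex.Re (Num.conj a) = complex.Re a.
Proof. by case: a. Qed.
Lemma ImJ (a : C) : complex.Im (Num.conj a) = - complex.Im a.
Proof. by case: a. Qed.
Lemma complex_ext (a b : C) :
  complex.Re a = complex.Re b -> complex.Im a = complex.Im b -> a = b.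
Proof. by case: a b => [? ?] [? ?] /= -> ->. Qed.

Lemma ccont_cst c : ccont (fun=> c).
Proof. by split=> x; exact: cvg_cst. Qed.

Lemma ccontD f g : ccont f -> ccont g -> ccont (fun x => f x + g x).
Proof.
move=> [f1 f2] [g1 g2]; split=> x.
  under eq_fun do rewrite ReD.
  by apply: cvgD; [exact: f1|exact: g1].
under eq_fun do rewrite ImD.
by apply: cvgD; [exact: f2|exact: g2].
Qed.

Lemma ccontM f g : ccont f -> ccont g -> ccont (fun x => f x * g x).
Proof.
move=> [f1 f2] [g1 g2]; split=> x.
  under eq_fun do rewrite ReM.
  apply: cvgB; apply: cvgM;
    by [exact: f1|exact: g1|exact: f2|exact: g2].
under eq_fun do rewrite ImM.
apply: cvgD; apply: cvgM;
  by [exact: f1|exact: g1|exact: f2|exact: g2].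
Qed.

Lemma ccontJ f : ccont f -> ccont (fun x => Num.conj (f x)).
Proof.
move=> [f1 f2]; split=> x.
  by under eq_fun do rewrite ReJ; exact: f1.
by under eq_fun do rewrite ImJ; apply: cvgN; exact: f2.
Qed.

Lemma ccont_sum (T : finType) (F : T -> G -> C) :
  (forall t, ccont (F t)) -> ccont (fun x => \sum_t F t x).
Proof.
move=> hF; elim: (index_enum T) => [|t s IHs].
  by under eq_fun do rewrite big_nil; exact: ccont_cst.
by under eq_fun do rewrite big_cons; exact: ccontD.
Qed.

Lemma ccont_prod (T : finType) (F : T -> G -> C) :
  (forall t, ccont (F t)) -> ccont (fun x => \prod_t F t x).
Proof.
move=> hF; elim: (index_enum T) => [|t s IHs].
  by under eq_fun do rewrite big_nil; exact: ccont_cst.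
by under eq_fun do rewrite big_cons; exact: ccontM.
Qed.

Lemma ccontX f n : ccont f -> ccont (fun x => f x ^+ n).
Proof.
move=> hf; elim: n => [|n IHn]; first exact: ccont_cst.
by under eq_fun do rewrite exprS; exact: ccontM.
Qed.

Lemma cintD f g : ccont f -> ccont g -> cint (fun x => f x + g x) = cint f + cint g.
Proof.
case: haarI => addI _ _ _ _ [f1 f2] [g1 g2]; apply: complex_ext; rewrite ?ReD ?ImD /=.
  by under eq_fun do rewrite ReD; exact: addI.
by under eq_fun do rewrite ImD; exact: addI.
Qed.

Lemma cintZ c f : ccont f -> cint (fun x => c * f x) = c * cint f.
Proof.
case: haarI => addI sclI _ _ _ [f1 f2].
have scl_cont (a : R) (h : G -> R) : continuous h -> continuous (fun x => a * h x).
  by move=> hh x; apply: cvgM; [exact: cvg_cst|exact: hh].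
apply: complex_ext; rewrite ?ReM ?ImM /=.
  under eq_fun do rewrite ReM -mulNr.
  by rewrite addI ?sclI ?mulNr //; exact: scl_cont.
under eq_fun do rewrite ImM.
by rewrite addI ?sclI //; exact: scl_cont.
Qed.

Lemma cintJ f : ccont f -> cint (fun x => Num.conj (f x)) = Num.conj (cint f).
Proof.
case: haarI => addI sclI _ _ _ [f1 f2]; apply: complex_ext; rewrite ?ReJ ?ImJ /=.
  by under eq_fun do rewrite ReJ.
by under eq_fun do rewrite ImJ -mulN1r; rewrite sclI // mulN1r.
Qed.

Lemma haar_cst (r : R) : I (fun=> r) = r.
Proof.
case: haarI => _ sclI _ I1 _; rewrite -[RHS]mulr1 -I1 -sclI; last by move=> x; exact: cvg_cst.
by congr I; apply/funext => x; rewrite mulr1.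
Qed.

Lemma cint_cst c : cint (fun=> c) = c.
Proof. by rewrite /cint !haar_cst; case: c. Qed.

Lemma cint_sum (T : finType) (F : T -> G -> C) : (forall t, ccont (F t)) ->
  cint (fun x => \sum_t F t x) = \sum_t cint (F t).
Proof.
move=> hF; elim: (index_enum T) => [|t s IHs].
  by under eq_fun do rewrite big_nil; rewrite big_nil cint_cst.
under eq_fun do rewrite big_cons.
rewrite big_cons -IHs cintD //.
(* What remains is the continuity of the partial sum over [s]. *)
elim: (s) => [|a s' IH].
  by under eq_fun do rewrite big_nil; exact: ccont_cst.
by under eq_fun do rewrite big_cons; exact: ccontD.
Qed.

Lemma cint_ge0 f : ccont f -> (forall x, 0 <= f x) -> 0 <= cint f.
Proof.
case: haarI => _ _ posI _ _ [f1 f2] f0; rewrite lecE /=; apply/andP; split.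
  (* Nonnegative elements of [R[i]] have zero imaginary part. *)
  rewrite (_ : (fun g => _) = fun=> 0) ?haar_cst //.
  by apply/funext => x; rewrite ger0_Im.
apply: posI => // x; have := f0 x.
by rewrite lecE => /andP[].
Qed.

Lemma le_cint f g : ccont f -> ccont g -> (forall x, f x <= g x) -> cint f <= cint g.
Proof.
move=> hf hg fg; rewrite -subr_ge0 -mulN1r -cintZ // -cintD //; last first.
  by apply: ccontM => //; exact: ccont_cst.
apply: cint_ge0 => [|x]; last by rewrite mulN1r subr_ge0.
by apply: ccontD => //; apply: ccontM => //; exact: ccont_cst.
Qed.

Lemma cint_translate a f : ccont f -> cint (fun x => f (mul a x)) = cint f.
Proof.
case: haarI => _ _ _ _ invI [f1 f2]; rewrite /cint.
by rewrite -(invI a _ f1) -(invI a _ f2).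
Qed.

Definition mcont m n (F : G -> 'M[C]_(m, n)) : Prop :=
  forall i j, ccont (fun g => F g i j).

Definition mint m n (F : G -> 'M[C]_(m, n)) : 'M[C]_(m, n) :=
  \matrix_(i, j) cint (fun g => F g i j).

Lemma mcont_cst m n (A : 'M[C]_(m, n)) : mcont (fun=> A).
Proof. by move=> i j; exact: ccont_cst. Qed.

Lemma mcont_mul m n p (F : G -> 'M[C]_(m, n)) (H : G -> 'M[C]_(n, p)) :
  mcont F -> mcont H -> mcont (fun g => F g *m H g).
Proof.
move=> hF hH i j; under eq_fun do rewrite mxE.
by apply: ccont_sum => l; exact: ccontM.
Qed.

Lemma mcont_adj m n (F : G -> 'M[C]_(m, n)) : mcont F -> mcont (fun g => adjm (F g)).
Proof. by move=> hF i j; under eq_fun do rewrite adjmE; exact: ccontJ. Qed.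

Lemma mint_mull m n p (A : 'M[C]_(m, n)) (F : G -> 'M[C]_(n, p)) : mcont F ->
  mint (fun g => A *m F g) = A *m mint F.
Proof.
move=> hF; apply/matrixP => i j; rewrite !mxE; under eq_fun do rewrite mxE.
rewrite cint_sum => [|l]; last by apply: ccontM => //; exact: ccont_cst.
by apply: eq_bigr => l _; rewrite mxE cintZ.
Qed.

Lemma mint_mulr m n p (A : 'M[C]_(n, p)) (F : G -> 'M[C]_(m, n)) : mcont F ->
  mint (fun g => F g *m A) = mint F *m A.
Proof.
move=> hF; apply/matrixP => i j; rewrite !mxE; under eq_fun do rewrite mxE.
rewrite cint_sum => [|l]; last by apply: ccontM => //; exact: ccont_cst.
apply: eq_bigr => l _; rewrite mxE mulrC -cintZ //.
by congr cint; apply/funext => x; rewrite mulrC.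
Qed.

Lemma mint_adj m n (F : G -> 'M[C]_(m, n)) : mcont F ->
  mint (fun g => adjm (F g)) = adjm (mint F).
Proof.
move=> hF; apply/matrixP => i j; rewrite !mxE -cintJ //.
by congr cint; apply/funext => x; rewrite adjmE.
Qed.

Lemma mintD m n (F H : G -> 'M[C]_(m, n)) : mcont F -> mcont H ->
  mint (fun g => F g + H g) = mint F + mint H.
Proof.
move=> hF hH; apply/matrixP => i j; rewrite !mxE -cintD //.
by congr cint; apply/funext => x; rewrite mxE.
Qed.

Lemma mint_cst m n (A : 'M[C]_(m, n)) : mint (fun=> A) = A.
Proof. by apply/matrixP => i j; rewrite mxE cint_cst. Qed.

Lemma mint_translate m n a (F : G -> 'M[C]_(m, n)) : mcont F ->
  mint (fun x => F (mul a x)) = mint F.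
Proof. by move=> hF; apply/matrixP => i j; rewrite !mxE (cint_translate a (hF i j)). Qed.

Lemma hform_mint n (F : G -> 'M[C]_n) v w : mcont F ->
  hform (mint F) v w = cint (fun g => hform (F g) v w).
Proof.
move=> hF; have hvF : mcont (fun g => v *m F g).
  by apply: mcont_mul => //; exact: mcont_cst.
by rewrite hformE -mint_mull // -mint_mulr // mxE; congr cint; apply/funext => g; rewrite hformE.
Qed.

Lemma ccont_hform n (F : G -> 'M[C]_n) v w : mcont F -> ccont (fun g => hform (F g) v w).
Proof.
move=> hF; under eq_fun do rewrite hformE.
by apply: (mcont_mul (mcont_mul (mcont_cst v) hF) (mcont_cst (adjm w))).
Qed.

Lemma mxtrace_mint n (F : G -> 'M[C]_n) : mcont F ->
  \tr (mint F) = cint (fun g => \tr (F g)).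
Proof.
move=> hF; rewrite cint_sum; last by move=> i; exact: hF.
by apply: eq_bigr => i _; rewrite mxE.
Qed.

(** * The group average as a covariant expectation *)

Section Twirl.
Variables (N : nat) (U : G -> 'M[C]_N).
Hypothesis repU : unitary_rep mul U.

Definition twirl (X : 'M[C]_N) : 'M[C]_N :=
  mint (fun g => U g *m X *m adjm (U g)).

Let contU : mcont U.
Proof. by case: repU => _ _ h i j; exact: h. Qed.

Lemma mcont_twirl X : mcont (fun g => U g *m X *m adjm (U g)).
Proof.
apply: mcont_mul; last exact: mcont_adj.
by apply: mcont_mul => //; exact: mcont_cst.
Qed.
Local Hint Resolve mcont_twirl : core.

Lemma commutant_adj Z g : commutant U Z -> Z *m adjm (U g) = adjm (U g) *m Z.
Proof.
case: repU => uU _ _ /(_ g) h.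
rewrite -[LHS]mul1mx -(unitary_adjl (uU g)) -!mulmxA; congr (_ *m _).
by rewrite mulmxA -h -mulmxA uU mulmx1.
Qed.

Lemma twirlM Z X W : commutant U Z -> commutant U W ->
  twirl (Z *m X *m W) = Z *m twirl X *m W.
Proof.
move=> cZ cW; rewrite /twirl -mint_mull // -mint_mulr; last first.
  by apply: mcont_mul => //; exact: mcont_cst.
congr mint; apply/funext => g.
by rewrite !mulmxA -cZ -!mulmxA (commutant_adj g cW).
Qed.

Lemma twirlD X Y : twirl (X + Y) = twirl X + twirl Y.
Proof.
rewrite /twirl -mintD //; congr mint; apply/funext => g.
by rewrite mulmxDr mulmxDl.
Qed.

(** Scalar matrices are in the commutant, so this is a case of [twirlM]. *)
Lemma twirlZ c X : twirl (c *: X) = c *: twirl X.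
Proof.
have cc : commutant U c%:M by move=> g; rewrite mul_scalar_mx mul_mx_scalar.
by rewrite -!mul_scalar_mx -[LHS]mulmx1 -[RHS]mulmx1 -twirlM ?mulmx1 //; exact: commutant1.
Qed.

Lemma twirl_fix X : commutant U X -> twirl X = X.
Proof.
case: repU => uU _ _ cX; rewrite /twirl -[RHS]mint_cst; congr mint; apply/funext => g.
by rewrite -cX -mulmxA uU mulmx1.
Qed.

(** Conjugation by [U h] replaces [g] by [mul h g] under the integral, so left invariance makes the
    average a fixed point. *)
Lemma commutant_twirl X : commutant U (twirl X).
Proof.
case: repU => uU mU _ h.
have E : U h *m twirl X *m adjm (U h) = twirl X.
  rewrite /twirl -mint_mull // -mint_mulr; last by apply: mcont_mul => //; exact: mcont_cst.
  rewrite -(mint_translate h (mcont_twirl X)); congr mint; apply/funext => g.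
  by rewrite mU adjm_mul !mulmxA.
by rewrite -[in LHS]E -!mulmxA (unitary_adjl (uU h)) mulmx1.
Qed.

(** Moves the average onto the vectors, so that inequalities between forms integrate pointwise. *)
Lemma hform_twirl X v w : hform (twirl X) v w = cint (fun g => hform X (v *m U g) (w *m U g)).
Proof.
rewrite hform_mint //; congr cint; apply/funext => g.
by rewrite hform_mull hform_mulr.
Qed.

Lemma ccont_hform_rep X v w : ccont (fun g => hform X (v *m U g) (w *m U g)).
Proof.
under eq_fun do rewrite hform_mull hform_mulr.
by apply: ccont_hform => i j; exact: mcont_twirl.
Qed.

Lemma twirl_le X Y : lemx X Y -> lemx (twirl X) (twirl Y).
Proof.
move=> XY v; rewrite !hform_twirl; apply: le_cint; [exact: ccont_hform_rep..|move=> g].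
exact: XY.
Qed.

Lemma psd_twirl X : psdm X -> psdm (twirl X).
Proof.
move=> pX; apply: psd_hform => [|v].
  rewrite /twirl -mint_adj //; congr mint; apply/funext => g.
  by rewrite !adjm_mul adjmK (psd_adj pX) mulmxA.
rewrite hform_twirl; apply: cint_ge0; first exact: ccont_hform_rep.
by move=> g; exact: psd_hform_ge0.
Qed.

Lemma mxtrace_twirl X : \tr (twirl X) = \tr X.
Proof.
case: repU => uU _ _; rewrite mxtrace_mint // -[RHS]cint_cst; congr cint; apply/funext => g.
by rewrite mxtrace_mulC mulmxA (unitary_adjl (uU g)) mul1mx.
Qed.

Lemma twirl_amgm M A B :
  (forall v w, hform M v w + hform M w v <= hform A v v + hform B w w) ->
  forall v w, hform (twirl M) v w + hform (twirl M) w v <=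
              hform (twirl A) v v + hform (twirl B) w w.
Proof.
move=> h v w; rewrite !hform_twirl -!cintD; [|exact: ccont_hform_rep..].
apply: le_cint => [||g]; [apply: ccontD; exact: ccont_hform_rep..|exact: h].
Qed.

(* The matrix [twirl (e* e)] averages the projections on the vectors [U g e*],
   whose coordinates are combinations of the [#|K|] functions [F t]. *)
Lemma rank_twirl (K : finType) (c : 'I_N -> 'I_N -> K) (F : K -> G -> C) :
  (forall t, ccont (F t)) -> (forall g x y, U g x y = F (c x y) g) ->
  forall e : 'rV[C]_N, (\rank (twirl (adjm e *m e)) <= #|K|)%N.
Proof.
move=> cF UF e.
pose h x g := (U g *m adjm e) x 0.
have ch x : ccont (h x) by apply: mcont_mul contU (mcont_cst _) _ _.
pose b t y := \sum_(q | c y q == t) Num.conj (e 0 q).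
have hE g y : h y g = \sum_t F t g * b t y.
  rewrite /h mxE (partition_big (c y) predT) //=; apply: eq_bigr => t _.
  rewrite mulr_sumr; apply: eq_bigr => q /eqP <-.
  by rewrite adjmE UF.
(* Only the conjugated factor of [h x g * Num.conj (h y g)] is expanded in the [F t]; the sum over
   [t] becomes a product through dimension [#|K|]. *)
pose L : 'M[C]_(N, #|K|) :=
  \matrix_(x, t) cint (fun g => h x g * Num.conj (F (enum_val t) g)).
pose W : 'M[C]_(#|K|, N) := \matrix_(t, y) Num.conj (b (enum_val t) y).
suff -> : twirl (adjm e *m e) = L *m W by exact: mulmx_max_rank.
apply/matrixP => x y; rewrite [RHS]mxE [LHS]mxE.
have -> : (fun g => (U g *m (adjm e *m e) *m adjm (U g)) x y) =
    fun g => \sum_(t : K) Num.conj (b t y) * (h x g * Num.conj (F t g)).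
  apply/funext => g.
  have -> : U g *m (adjm e *m e) *m adjm (U g) = (U g *m adjm e) *m adjm (U g *m adjm e).
    by rewrite adjm_mul adjmK !mulmxA.
  rewrite mxE big_ord1 adjmE -/(h x g) -/(h y g) (hE g y) rmorph_sum mulr_sumr.
  by apply: eq_bigr => t _; rewrite rmorphM /= mulrA mulrC.
rewrite cint_sum => [|t]; last first.
  by apply: ccontM; [exact: ccont_cst|apply: ccontM => //; exact: ccontJ].
rewrite [RHS](reindex_onto enum_rank enum_val) /=; last by move=> t _; rewrite enum_valK.
apply: eq_big => [t|t _]; first by rewrite enum_rankK eqxx.
by rewrite !mxE enum_rankK mulrC cintZ //; apply: ccontM => //; exact: ccontJ.
Qed.

Lemma twirl_covariant (K : finType) (c : 'I_N -> 'I_N -> K) (F : K -> G -> C) :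
  (forall t, ccont (F t)) -> (forall g x y, U g x y = F (c x y) g) ->
  covariant_expectation U #|K| twirl.
Proof.
move=> cF UF; split.
- exact: twirlD.
- exact: twirlZ.
- exact: twirl_le.
- exact: psd_twirl.
- exact: twirl_amgm.
- exact: twirlM.
- exact: twirl_fix.
- exact: commutant_twirl.
- exact: mxtrace_twirl.
- exact: rank_twirl cF UF.
Qed.

End Twirl.
End ComplexIntegral.

Lemma Eavg_twirl (R : realType) (G : topologicalType) k (u : G -> 'M[R[i]]_k) I n
    (X : 'M[R[i]]_(k ^ n)) :
  Eavg u I X = twirl I (tpow_rep u n) X.
Proof. by apply/matrixP => i j; rewrite !mxE. Qed.

(** * Lower and upper limits of logarithmic rates *)

Section Limits.
Set Implicit Arguments.
Unset Strict Implicit.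
Context {R : realType}.

(** Index 0, where [rate_seq] has the default factor [0^-1 = 0], is left out. *)
Lemma limn_einf_ge (u : (\bar R)^nat) c : (forall n, (c <= u n.+1)%E) -> (c <= limn_einf u)%E.
Proof.
move=> cu; rewrite limn_einf_lim; apply: lime_ge; first exact: is_cvg_einfs.
exists 1%N => // n /= n0; apply: le_ereal_inf_tmp => _ [m /= nm] <-.
by case: m nm => [|m _]; [case: n n0|exact: cu].
Qed.

Lemma limn_esup_le (u : (\bar R)^nat) c M :
  (forall n, (M <= n)%N -> (u n.+1 <= c)%E) -> (limn_esup u <= c)%E.
Proof.
move=> cu; rewrite limn_esup_lim; apply: lime_le; first exact: is_cvg_esups.
exists M.+1 => // n /= n0; apply: ge_ereal_sup => _ [m /= nm] <-.
by case: m nm => [|m nm]; [case: n n0|apply: cu; rewrite -ltnS (leq_trans n0)].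
Qed.

(** From [ln (d x) <= d x - 1] follows [ln x <= d x + |1 + ln d|]. The slope [d] uses up half of
    [eps]; large [n] lets the other half absorb the constants. The [a + 1] in [d] covers [a = 0]. *)
Lemma ln_sublinear (a eps : R) : 0 <= a -> 0 < eps ->
  exists M, forall n, (M <= n)%N -> a * ln n.+2%:R <= eps * n.+1%:R.
Proof.
move=> a0 e0; pose d := eps / (2 * (a + 1)).
have d0 : 0 < d by rewrite divr_gt0 // mulr_gt0 // ltr_wpDl.
have ad : a * d <= eps / 2.
  rewrite /d mulrCA ler_pM2l // invfM mulrCA ger_pMr ?invr_gt0 //.
  by rewrite ler_pdivrMr ?mul1r ?lerDl // ltr_wpDl.
(* The summand [eps / 2] accounts for [n + 2] exceeding [n + 1] by one. *)
pose c := eps / 2 + a * `|1 + ln d|.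
pose M := Num.trunc (c / (eps / 2)).
exists M => n Mn.
have n2 : 0 < n.+2%:R :> R by rewrite ltr0n.
have h : ln n.+2%:R <= d * n.+2%:R + `|1 + ln d|.
  have : ln (d * n.+2%:R) <= d * n.+2%:R - 1.
    by rewrite -[X in ln X](subrK 1) addrC le_ln1Dx // ltrBrDl subrr mulr_gt0.
  rewrite lnM ?posrE //; have := ler_norm (- (1 + ln d)); rewrite normrN; lra.
have Mc : c / (eps / 2) <= n.+1%:R.
  by apply: le_trans (ltW (truncnS_gt _)) _; rewrite ler_nat.
move: Mc; rewrite ler_pdivrMr ?divr_gt0 // => Mc.
apply: le_trans (ler_wpM2l a0 h) _.
rewrite mulrDr mulrA -[n.+2%:R]natr1.
have := ler_wpM2r (ltW n2) ad; rewrite -[n.+2%:R]natr1 => h2.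
move: Mc; rewrite /c; lra.
Qed.

Lemma elog_rate_ge (T t : R) n : 0 <= T -> T ^+ n.+1 <= t ->
  (elog T <= (n.+1%:R^-1)%:E * elog t)%E.
Proof.
move=> T0 Tt; rewrite /elog; case: eqP => [_|/eqP nT]; first exact: leNye.
have T1 : 0 < T by rewrite lt_def nT.
have Tn : 0 < T ^+ n.+1 by rewrite exprn_gt0.
have t0 : 0 < t by exact: lt_le_trans Tt.
rewrite (gt_eqF t0) -EFinM lee_fin ler_pdivlMl ?ltr0n // mulr_natl -lnXn //.
by rewrite ler_ln ?posrE.
Qed.

Lemma elog_rate_le0 (t : R) n : t = 0 -> ((n.+1%:R^-1)%:E * elog t = -oo)%E.
Proof. by move=> ->; rewrite /elog eqxx gt0_muleNy // lte_fin invr_gt0 ltr0n. Qed.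

Lemma elog_rate_le (T t eps : R) K n : 0 < T -> 0 <= t ->
  t <= Num.sqrt (n.+2 ^ K)%:R * T ^+ n.+1 ->
  K%:R / 2 * ln n.+2%:R <= eps * n.+1%:R ->
  ((n.+1%:R^-1)%:E * elog t <= elog T + eps%:E)%E.
Proof.
move=> T0 t0 tT h; rewrite /elog (gt_eqF T0); case: eqP => [_|/eqP nt].
  by rewrite gt0_muleNy ?leNye // lte_fin invr_gt0 ltr0n.
have t1 : 0 < t by rewrite lt_def nt.
have n2 : 0 < n.+2%:R :> R by rewrite ltr0n.
have s0 : 0 < Num.sqrt (n.+2 ^ K)%:R :> R by rewrite sqrtr_gt0 ltr0n expn_gt0.
have Tn : 0 < T ^+ n.+1 by rewrite exprn_gt0.
rewrite -EFinM -EFinD lee_fin ler_pdivrMl ?ltr0n //.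
move: tT; rewrite -ler_ln ?posrE ?mulr_gt0 // lnM ?posrE // lnXn //.
(* Doubling the logarithm removes the square root. *)
have : ln (Num.sqrt (n.+2 ^ K)%:R) *+ 2 = K%:R * ln n.+2%:R :> R.
  by rewrite -lnXn // sqr_sqrtr ?ler0n // natrX lnXn // mulr_natl.
rewrite -(mulr_natl (ln T)) -[_ *+ 2]mulr_natl => e1 e2; lra.
Qed.

End Limits.

(** * Specialisation to [R[i]] and the bounds at each tensor power *)

Section Main.
Set Implicit Arguments.
Unset Strict Implicit.
Context {R : realType}.
Local Notation C := R[i].
Local Notation toC := (real_complex R : {rmorphism R -> R[i]}).
Local Notation re := (@complex.Re R).

Lemma toC_leE x y : (toC x <= toC y) = (x <= y). Proof. exact: lecR. Qed.
Lemma toC_conjE x : Num.conj (toC x) = toC x. Proof. exact: conjc_real. Qed.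
Lemma toC_reE z : z \is Num.real -> toC (re z) = z. Proof. exact: RRe_real. Qed.
Lemma re_toCE x : re (toC x) = x. Proof. by []. Qed.

Lemma mxpowE n (A : 'M[C]_n) s : mxpow A s = mpow toC re A s.
Proof. by rewrite /mpow unlock. Qed.

Lemma trnormE n (X : 'M[C]_n) : toC (trnorm X) = mtrn toC re X.
Proof.
rewrite /trnorm /absmx mxpowE toC_reE //; apply: ger0_real.
exact: (mtrn_ge0 toC_leE toC_conjE toC_reE re_toCE).
Qed.

Lemma trnorm_ge0 n (X : 'M[C]_n) : 0 <= trnorm X.
Proof.
have := mtrn_ge0 toC_leE toC_conjE toC_reE re_toCE X.
by rewrite -trnormE -(rmorph0 toC) toC_leE.
Qed.

Lemma unitary_rep_ntens (G : topologicalType) (mul : G -> G -> G) k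
    (u : G -> 'M[C]_k) n : unitary_rep mul u -> unitary_rep mul (tpow_rep u n.+1).
Proof.
move=> [uu mu cu]; split=> [g|a b|i j].
- exact: unitarym_ntens (uu g).
- by rewrite /tpow_rep mu ntens_mul.
have [c cE] := @ntens_monomial C k n.
have -> : (fun g => re (tpow_rep u n.+1 g i j)) =
    fun g => re (\prod_p u g p.1 p.2 ^+ c i j p) by apply/funext => g; rewrite -cE.
have -> : (fun g => complex.Im (tpow_rep u n.+1 g i j)) =
    fun g => complex.Im (\prod_p u g p.1 p.2 ^+ c i j p) by apply/funext => g; rewrite -cE.
by apply: ccont_prod => p; apply: ccontX; exact: cu.
Qed.

Section Bounds.
Variables (G : topologicalType) (mul : G -> G -> G) (I : (G -> R) -> R).
Variables (k : nat) (u : G -> 'M[C]_k) (rho0 rho1 : 'M[C]_k).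
Hypothesis haarI : haar_integral mul I.
Hypothesis repu : unitary_rep mul u.
Hypothesis psd0 : psdm rho0.
Hypothesis psd1 : psdm rho1.
Hypothesis comm1 : forall g, rho1 *m u g = u g *m rho1.

(** The rank bound counts the exponent functions on the [k * k] entries with values in ['I_n.+2],
    hence is polynomial in [n]. *)
Lemma covariant_Eavg n :
  covariant_expectation (tpow_rep u n.+1) (n.+2 ^ (k * k)) (@Eavg R G k u I n.+1).
Proof.
have [c cE] := @ntens_monomial C k n.
have -> : (n.+2 ^ (k * k))%N = #|{ffun 'I_k * 'I_k -> 'I_n.+2}|.
  by rewrite card_ffun card_prod !card_ord.
have -> : @Eavg R G k u I n.+1 = twirl I (tpow_rep u n.+1).
  by apply/funext => X; exact: Eavg_twirl.
pose F (t : {ffun 'I_k * 'I_k -> 'I_n.+2}) g := \prod_p u g p.1 p.2 ^+ t p.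
apply: (twirl_covariant haarI (unitary_rep_ntens n repu) (c := c) (F := F)) => [t|g x y].
  by apply: ccont_prod => p; apply: ccontX; case: repu => _ _; apply.
exact: cE.
Qed.

Lemma commutant_ntens n : commutant (tpow_rep u n.+1) (ntensmx rho1 n.+1).
Proof. by move=> g; rewrite /tpow_rep !ntens_mul comm1. Qed.

Lemma trnorm_ntens n s :
  toC (trnorm (mxpow rho0 s *m mxpow rho1 (1 - s)) ^+ n.+1) =
  mtrn toC re (mpow toC re (ntensmx rho0 n.+1) s *m
               mpow toC re (ntensmx rho1 n.+1) (1 - s)).
Proof.
rewrite !(mpow_ntens toC_leE toC_conjE toC_reE re_toCE) //.
rewrite ntens_mul (mtrn_ntens toC_leE toC_conjE toC_reE re_toCE).
by rewrite rmorphXn /= -!mxpowE -trnormE.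
Qed.

Lemma trnorm_rho_n n s :
  toC (trnorm (mxpow (rho_n u I rho0 n.+1) s *m mxpow (rho_n u I rho1 n.+1) (1 - s))) =
  mtrn toC re (mpow toC re (Eavg u I (ntensmx rho0 n.+1)) s *m
               mpow toC re (ntensmx rho1 n.+1) (1 - s)).
Proof.
have -> : rho_n u I rho1 n.+1 = ntensmx rho1 n.+1.
  exact: (cexp_fix (covariant_Eavg n) (commutant_ntens n)).
rewrite (mxpowE (rho_n u I rho0 n.+1) s) (mxpowE (ntensmx rho1 n.+1) (1 - s)).
exact: trnormE.
Qed.

Lemma trnorm_rho_n_ge n s : 0 <= s <= 2^-1 ->
  trnorm (mxpow rho0 s *m mxpow rho1 (1 - s)) ^+ n.+1 <=
  trnorm (mxpow (rho_n u I rho0 n.+1) s *m mxpow (rho_n u I rho1 n.+1) (1 - s)).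
Proof.
move=> s01; rewrite -toC_leE trnorm_ntens trnorm_rho_n.
apply: (cexp_mtrn_ge toC_leE toC_conjE toC_reE re_toCE (covariant_Eavg n)) => //.
- exact: (psdm_ntens toC_leE toC_conjE toC_reE).
- exact: (psdm_ntens toC_leE toC_conjE toC_reE).
- exact: commutant_ntens.
Qed.

Lemma trnorm_rho_n_le n s : 2^-1 <= s <= 1 ->
  trnorm (mxpow (rho_n u I rho0 n.+1) s *m mxpow (rho_n u I rho1 n.+1) (1 - s)) <=
  Num.sqrt (n.+2 ^ (k * k))%:R * trnorm (mxpow rho0 s *m mxpow rho1 (1 - s)) ^+ n.+1.
Proof.
move=> s01; rewrite -toC_leE rmorphM trnorm_ntens trnorm_rho_n.
apply: (cexp_mtrn_le toC_leE toC_conjE toC_reE re_toCE (covariant_Eavg n)) => //.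
- exact: (psdm_ntens toC_leE toC_conjE toC_reE).
- exact: (psdm_ntens toC_leE toC_conjE toC_reE).
- exact: commutant_ntens.
Qed.

End Bounds.
End Main.

Theorem theorem5p3 (R : realType) (G : topologicalType)
  (mul : G -> G -> G) (inv : G -> G) (one : G)
  (I : (G -> R) -> R) (k : nat) (u : G -> 'M[R[i]]_k)
  (rho0 rho1 : 'M[R[i]]_k) :
  is_compact_group mul inv one ->
  haar_integral mul I ->
  unitary_rep mul u ->
  density_mx rho0 -> density_mx rho1 ->
  (forall g, rho1 *m u g = u g *m rho1) ->
  (forall s : R, 0 <= s <= 2^-1 ->
     (elog (trnorm (mxpow rho0 s *m mxpow rho1 (1 - s)))
        <= limn_einf (rate_seq u I rho0 rho1 s))%E) /\
  (forall s : R, 2^-1 <= s <= 1 ->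
     (limn_esup (rate_seq u I rho0 rho1 s)
        <= elog (trnorm (mxpow rho0 s *m mxpow rho1 (1 - s))))%E).
Proof.
move=> _ haarI repu [psd0 _] [psd1 _] comm1; split=> s s01.
  apply: limn_einf_ge => n; apply: elog_rate_ge; first exact: trnorm_ge0.
  exact: (trnorm_rho_n_ge haarI repu psd0 psd1 comm1 n s01).
set T := trnorm _.
have bound n := trnorm_rho_n_le haarI repu psd0 psd1 comm1 n s01.
(* If [T = 0] the right side is [-oo], and the bound forces every trace norm with positive index to
   vanish too. *)
have [T0|Tn0] := eqVneq T 0.
  apply: (limn_esup_le (M := 0)) => n _; rewrite /rate_seq elog_rate_le0 ?leNye //.
  apply/eqP; rewrite eq_le trnorm_ge0 andbT.
  by have := bound n; rewrite -/T T0 expr0n mulr0.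
have Tp : 0 < T by rewrite lt_def Tn0 trnorm_ge0.
apply/lee_addgt0Pr => eps eps0.
(* In the logarithm, the square root of [(n + 2)^(k * k)] costs [(k * k) / 2] times [ln (n + 2)],
   eventually below [eps (n + 1)]. *)
have [M hM] := @ln_sublinear R ((k * k)%:R / 2) eps (divr_ge0 (ler0n _ _) (ler0n _ _)) eps0.
apply: (limn_esup_le (M := M)) => n Mn.
exact: (elog_rate_le Tp (trnorm_ge0 _) (bound n) (hM n Mn)).
Qed.
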